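(* $Z_{\{\pm1\}}(N)\to\infty$ as $N\to\infty$, where $Z_{\{\pm1\}}(N)$ denotes the minimum number of zeros in $[0,2\pi]$ of a cosine polynomial $f(\theta)=\sum_{n=0}^N A_n\cos n\theta$ with all coefficients $A_n\in\{-1,1\}$.
   Context: For a cosine polynomial $f$, $Z(f)$ denotes the number of (distinct) zeros of $f$ in $[0,2\pi]$. Define $Z_{\{\pm1\}}(N)=\min_f Z(f)$, where the minimum is over all $f(\theta)=\sum_{n=0}^NA_n\cos n\theta$ with $A_n\in\{-1,1\}$ for every $0\le n\le N$. *)

(* Defs.v *)
From mathcomp Require Import all_boot all_order all_algebra.
From mathcomp Require Import all_classical all_reals all_analysis.
Set Implicit Arguments.
Unset Strict Implicit.
Unset Printing Implicit Defensive.
Import Order.TTheory GRing.Theory Num.Theory.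
Import numFieldNormedType.Exports.
Local Open Scope classical_set_scope.
Local Open Scope ring_scope.

Definition cos_poly (R : realType) (N : nat) (A : 'I_N.+1 -> R) (t : R) : R :=
  \sum_(n < N.+1) A n * cos (n%:R * t).

(* [counting] is the cardinality of a finite set and +oo on an infinite one,
   so zeros are counted without multiplicity. *)
Definition num_zeros (R : realType) (f : R -> R) : \bar R :=
  counting [set t : R | 0 <= t <= 2 * pi /\ f t = 0].

Definition pm1_coeffs (R : realType) (N : nat) : set ('I_N.+1 -> R) :=
  [set A | forall n : 'I_N.+1, A n = -1 \/ A n = 1].
Arguments pm1_coeffs : clear implicits.

(* The infimum is a minimum: see [min_zeros_pm1_attained]. *)
Definition min_zeros_pm1 (R : realType) (N : nat) : \bar R :=
  ereal_inf [set num_zeros (cos_poly A) | A in pm1_coeffs R N].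

Lemma min_zeros_pm1_attained (R : realType) (N : nat) :
  exists2 A, pm1_coeffs R N A & min_zeros_pm1 R N = num_zeros (cos_poly A).
Proof.
pose P (k : nat) := `[< exists2 A : 'I_N.+1 -> R,
  pm1_coeffs R N A & num_zeros (cos_poly A) = k%:R%:E >].
have numP A : pm1_coeffs R N A ->
    num_zeros (cos_poly A) = +oo%E \/
    exists2 k, P k & num_zeros (cos_poly A) = k%:R%:E.
  move=> hA; have [oo|noo] := eqVneq (num_zeros (cos_poly A)) +oo%E; first by left.
  have [k ek] : exists k : nat, num_zeros (cos_poly A) = k%:R%:E.
    by move: noo; rewrite /num_zeros /counting; case: ifP => // _ _; eexists.
  by right; exists k => //; apply/asboolP; exists A.
have [exP|nP] := pselect (exists k, P k).
  case: (ex_minnP exP) => k /asboolP[A hA eA] kmin.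
  exists A => //; apply/eqP; rewrite eq_le; apply/andP; split.
    by apply: ereal_inf_lbound; exists A.
  apply: le_ereal_inf_tmp => _ [B hB <-]; rewrite eA.
  have [->|[j Pj ->]] := numP B hB; first exact: leey.
  by rewrite lee_fin ler_nat kmin.
have h1 : pm1_coeffs R N (fun=> 1) by move=> n; right.
exists (fun=> 1) => //.
have all_oo B : pm1_coeffs R N B -> num_zeros (cos_poly B) = +oo%E.
  by move=> hB; have [//|[j Pj _]] := numP B hB; case: nP; exists j.
apply/eqP; rewrite eq_le; apply/andP; split.
  by apply: ereal_inf_lbound; exists (fun=> 1).
apply: le_ereal_inf_tmp => _ [B hB <-].
by rewrite !all_oo.
Qed.

(* Main.v *)
(* Suppose that for infinitely many N some f_N has fewer than K zeros. A product
   P_N of K factors cos t - x_j changes sign with f_N, so F_N = f_N P_N >= 0 (up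
   to the sign of f_N). Take limits along an ultrafilter, both of the low
   coefficients of F_N and of those near the frequency N: these are P a and P t,
   where a is even with entries +-1 off 0, t has entries +-1 on n <= 0 and
   vanishes on n > 0, and P is the limiting multiplier. Positivity makes the
   coefficients a Gram matrix <e_g, e_h>. In the spirit of F. and M. Riesz, a vector
   orthogonal to e_j for all j < 0 is asymptotically orthogonal to e_n as n grows;
   applied to a and to t this shows that both are eventually periodic, with a
   common period q. Let alpha_n = a_n - a_(n-q) and beta_n = t_n - t_(n-q), which
   are finitely supported. Comparing the mean of F_N against Fejer kernels in t and
   in N t gives |alpha(t)| >= 2 |beta(t)| off the zeros of P, hence everywhere.
   By Parseval on the q-th roots of unity, |beta|^2 sums to q^2, while |alpha|^2
   sums to at most 4 q (q - 1), because the odd function a_r - a_(-r) on the residues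
   mod q vanishes at r = 0. This is a contradiction. *)
Require Import Defs.
From mathcomp Require Import all_boot all_order all_algebra.
From mathcomp Require Import all_classical all_reals all_analysis.
From mathcomp Require Import zify ring lra.
Set Implicit Arguments.
Unset Strict Implicit.
Unset Printing Implicit Defensive.
Import Order.TTheory GRing.Theory Num.Theory.
Import numFieldNormedType.Exports.
Local Open Scope classical_set_scope.
Local Open Scope ring_scope.

(** * Positive semidefinite Toeplitz forms *)

Section QuadraticForm.
Variables (R : realType) (G : zmodType) (C : G -> R).
Implicit Types (X Y Z : seq (R * G)) (S : pred G).

(* A list of pairs (w, g) stands for the vector \sum w e_g, and C for the Gram
   matrix <e_g, e_h> = C (g - h). *)
Definition qform X Y : R :=
  \sum_(p <- X) \sum_(q <- Y) p.1 * q.1 * C (p.2 - q.2).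

Definition psd := forall X, 0 <= qform X X.

Definition lscale (c : R) X := [seq (c * p.1, p.2) | p <- X].

Definition lshift (s : G) X := [seq (p.1, p.2 + s) | p <- X].

Definition supp_in S X := all (fun p => S p.2) X.

(** Orthogonality up to an error [eps], relative to the norm of the test vector. An exact projection
    onto an infinite span need not be a finite combination, so only near-projections are used. *)
Definition near_orth (eps : R) S X :=
  forall Y, supp_in S Y -> qform X Y ^+ 2 <= eps * qform Y Y.

Lemma qform_catl X Y Z : qform (X ++ Y) Z = qform X Z + qform Y Z.
Proof. by rewrite /qform big_cat. Qed.

Lemma qform_catr X Y Z : qform Z (X ++ Y) = qform Z X + qform Z Y.
Proof.
by rewrite /qform -big_split; apply: eq_bigr => p _; rewrite big_cat.
Qed.

Lemma qform_scalel c X Y : qform (lscale c X) Y = c * qform X Y.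
Proof.
rewrite /qform big_map mulr_sumr; apply: eq_bigr => p _.
by rewrite mulr_sumr; apply: eq_bigr => q _ /=; ring.
Qed.

Lemma qform_scaler c X Y : qform Y (lscale c X) = c * qform Y X.
Proof.
rewrite /qform mulr_sumr; apply: eq_bigr => p _.
by rewrite big_map mulr_sumr; apply: eq_bigr => q _ /=; ring.
Qed.

Lemma qform_shift s X Y : qform (lshift s X) (lshift s Y) = qform X Y.
Proof.
rewrite /qform big_map; apply: eq_bigr => p _.
by rewrite big_map; apply: eq_bigr => q _ /=; rewrite opprD addrACA subrr addr0.
Qed.

Hypothesis evenC : forall g, C (- g) = C g.

Lemma qform_sym X Y : qform X Y = qform Y X.
Proof.
rewrite /qform exchange_big; apply: eq_bigr => p _; apply: eq_bigr => q _ /=.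
by rewrite -evenC opprB [q.1 * _]mulrC.
Qed.

Hypothesis psdC : psd.

(** Perturbing [X] by [s] times [Y] gives a quadratic polynomial in [s] that is nonnegative for
    every [s]; the bound is its discriminant inequality. *)
Lemma near_min_near_orth (d eps : R) S X :
  (forall Y, supp_in S Y -> d <= qform (X ++ Y) (X ++ Y)) ->
  qform X X <= d + eps -> near_orth eps S X.
Proof.
move=> dX Xd Y SY.
have pos (s : R) : 0 <= s ^+ 2 * qform Y Y + 2 * s * qform X Y + eps.
  have /dX : supp_in S (lscale s Y) by rewrite /supp_in all_map.
  rewrite qform_catl !qform_catr !qform_scalel !qform_scaler (qform_sym Y X).
  by move=> h; lra.
have eps0 : 0 <= eps by have := pos 0; lra.
have := psdC Y; rewrite le_eqVlt => /orP[/eqP q0|q0].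
  rewrite -q0 mulr0; have [->|b0] := eqVneq (qform X Y) 0; first by rewrite expr0n.
  (* For a null vector [Y] the polynomial is affine in [s]; this [s] would give it the value -1 if
     the slope were nonzero. *)
  have := pos (- (eps + 1) / (2 * qform X Y)); rewrite -q0.
  rewrite (_ : 2 * _ * _ = - (eps + 1)); first by lra.
  by field.
have := pos (- qform X Y / qform Y Y).
rewrite (_ : _ + _ = eps - qform X Y ^+ 2 / qform Y Y); last by field; lra.
by rewrite subr_ge0 ler_pdivrMr.
Qed.

(** The supremum of [D] is the squared distance from [X] to the span over [S], and some [Y] comes
    within [eps] of it. *)
Lemma near_projection (eps : R) S X : 0 < eps ->
  exists2 Y, supp_in S Y & near_orth eps S (X ++ Y).
Proof.
move=> eps0.
pose D := [set d : R | forall Y, supp_in S Y -> d <= qform (X ++ Y) (X ++ Y)].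
have supD : has_sup D.
  split; first by exists 0 => Y _; apply: psdC.
  by exists (qform X X) => d /(_ [::] isT); rewrite cats0.
have : ~ D (sup D + eps).
  by move=> /(ub_le_sup (proj2 supD)); lra.
move=> /existsNP[Y /not_implyP[SY /negP]]; rewrite -ltNge => Yd.
exists Y => //; apply: (@near_min_near_orth (sup D)); last exact: ltW.
move=> Z SZ; rewrite -catA; apply: ge_sup; first exact: (proj1 supD).
by move=> d; apply; rewrite /supp_in all_cat; apply/andP.
Qed.

End QuadraticForm.

(** The new function is the Gram function of the vectors e_g - e_(g+s). *)
Lemma psd_second_difference (R : realType) (G : zmodType) (C : G -> R) (s : G) :
  psd C -> psd (fun g => 2 * C g - C (g - s) - C (g + s)).
Proof.
move=> psdC X; have := psdC (X ++ lscale (-1) (lshift s X)).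
rewrite qform_catl !qform_catr !qform_scalel !qform_scaler qform_shift.
set l := (X in 0 <= X -> _).
have -> : l = 2 * qform C X X - qform C X (lshift s X) - qform C (lshift s X) X.
  by rewrite /l; ring.
rewrite /qform big_map mulr_sumr -!sumrB; congr (_ <= _).
apply: eq_bigr => p _; rewrite big_map mulr_sumr -!sumrB.
by apply: eq_bigr => q _ /=; rewrite opprD addrA (addrAC _ s); ring.
Qed.

(* The index (d, n) stands for the frequency d N + n in the limit N --> oo. *)
Definition past (m : int) : pred (int * int) := fun g => (g.1 == 0) && (g.2 < m).

Section TailOrthogonality.
Variables (R : realType) (C : int * int -> R).
Hypothesis evenC : forall g, C (- g) = C g.
Hypothesis psdC : psd C.

Let e (n : int) : seq (R * (int * int)) := [:: (1, (0, n))].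

Let supp_shift m n (X : seq (R * (int * int))) :
  supp_in (past m) (lshift (0, n) X) = supp_in (past (m - n)) X.
Proof.
rewrite /supp_in all_map; apply: eq_all => -[w [d k]] /=.
by rewrite /past /= addr0 ltrBrDr.
Qed.

Let sub_past m n (X : seq (R * (int * int))) :
  m <= n -> supp_in (past m) X -> supp_in (past n) X.
Proof.
move=> mn; apply: sub_all => -[w [i j]]; rewrite /past /= => /andP[-> /= jm].
exact: lt_le_trans mn.
Qed.

(* The distance from e_n to the span of the e_j with j < 0 increases with n to a
   finite limit, so for large n a near-projection h of e_n on that span is also
   a near-projection on the larger span of the e_j with j < M. Hence e_n - h is
   almost orthogonal to X, and so is h. *)
Lemma near_orth_tail : exists2 B : R, 0 < B &
  forall (X : seq (R * (int * int))) M eps, 0 < eps -> supp_in (past M) X -> near_orth C eps (past 0) X ->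
  exists n0 : nat, forall n : nat, (n0 <= n)%N -> qform C X (e n%:Z) ^+ 2 <= eps * B.
Proof.
pose u0 := qform C (e 0) (e 0).
have u0_ge0 : 0 <= u0 by exact: psdC.
have eE n : e n = lshift (0, n) (e 0) by rewrite /e /lshift /= add0r; congr [:: (_, (_, _))]; rewrite add0r.
have een n : qform C (e n) (e n) = u0 by rewrite eE qform_shift.
exists (8 * u0 + 6); first by lra.
move=> X M eps eps0 XM Xorth.
(* [sup D] is the limit of the squared distance from e_0 to the span of the e_j with j < -n,
   equivalently, after translation, from e_n to the span of the e_j with j < 0. *)
pose D := [set d : R | exists n : nat, forall Y, supp_in (past (- n%:Z)) Y ->
   d <= qform C (e 0 ++ Y) (e 0 ++ Y)].
have supD : has_sup D.
  split; first by exists 0, 0%N => Y _; exact: psdC.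
  by exists u0 => d [n /(_ [::] isT)]; rewrite cats0.
pose qX := qform C X X.
have qX0 : 0 <= qX by exact: psdC.
pose eta := Num.min 1 (eps / (2 * (qX + 1))).
have eta0 : 0 < eta by rewrite lt_min ltr01 /= divr_gt0 //; lra.
have eta1 : eta <= 1 by rewrite ge_min lexx.
have etaX : 2 * eta * qX <= eps.
  have : eta <= eps / (2 * (qX + 1)) by rewrite ge_min lexx orbT.
  rewrite ler_pdivlMr; last by lra.
  by move=> h; nra.
have [d [n1 dn1] d_gt] := sup_adherent eta0 supD.
(* By translation, the distance from e_n to the span of the e_j with j < m is almost the limit once
   n - m is at least [n1]. *)
have far m n : m + n1%:Z <= n -> forall Y, supp_in (past m) Y ->
    sup D - eta <= qform C (e n ++ Y) (e n ++ Y).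
  move=> mn Y mY; apply: (le_trans (ltW d_gt)).
  rewrite -(qform_shift C (0, - n)) /lshift map_cat -!/(lshift _ _) eE.
  rewrite (_ : lshift _ (lshift _ _) = e 0); last first.
    by rewrite /lshift /e /= !add0r; congr [:: (_, (_, _))]; rewrite ?add0r ?subrr.
  apply: dn1; rewrite supp_shift.
  by apply: (sub_past _ mY); move: mn; clear; lia.
exists (`|M|%N + n1)%N => n nM.
have [Y Y0 Yn] : exists2 Y, supp_in (past 0) Y &
    qform C (e n%:Z ++ Y) (e n%:Z ++ Y) <= sup D + eta.
  have : ~ D (sup D + eta).
    by move=> /(ub_le_sup (proj2 supD)); lra.
  move=> /forallNP/(_ n)/existsNP[Y /not_implyP[SY /negP]]; rewrite -ltNge => Yd.
  exists (lshift (0, n%:Z) Y).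
    by rewrite supp_shift; apply: (sub_past _ SY); clear; lia.
  by rewrite eE /lshift -map_cat -/(lshift _ _) qform_shift ltW.
have rX : qform C (e n%:Z ++ Y) X ^+ 2 <= 2 * eta * qX.
  apply: (@near_min_near_orth _ _ C evenC psdC (sup D - eta) _ (past M)) => //; last by lra.
  move=> Z ZM; rewrite -catA; apply: (far `|M|%N%:Z).
    by move: nM; clear; lia.
  rewrite /supp_in all_cat; apply/andP; split.
    by apply: (sub_past _ Y0); clear; lia.
  by apply: (sub_past _ ZM); clear; lia.
have supD_le : sup D <= u0.
  apply: ge_sup; first exact: (proj1 supD).
  by move=> d' [k /(_ [::] isT)]; rewrite cats0.
(* Positivity at 2 e_n + Y, combined with the bound on the norm of e_n + Y, bounds the norm of Y
   independently of n. *)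
have YY : qform C Y Y <= 4 * u0 + 2.
  have := psdC (e n%:Z ++ (e n%:Z ++ Y)).
  move: Yn; rewrite !(qform_catl, qform_catr) !een (qform_sym evenC Y (e _)).
  by move: eta1 supD_le; clear; lra.
have XY := Xorth Y Y0.
have : qform C X Y ^+ 2 <= eps * (4 * u0 + 2).
  by apply: (le_trans XY); rewrite ler_pM2l.
move: rX; rewrite qform_catl (qform_sym evenC _ X) (qform_sym evenC Y X).
set a := qform C X (e _); set b := qform C X Y.
move=> h1 h2.
have : 0 <= (a + 2 * b) ^+ 2 by rewrite sqr_ge0.
have -> : (a + 2 * b) ^+ 2 = 2 * (a + b) ^+ 2 + 2 * b ^+ 2 - a ^+ 2 by ring.
by lra.
Qed.

End TailOrthogonality.

(** * Coefficients of trigonometric polynomials *)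

Section SymmetricSums.
Variable R : realType.
Implicit Types (g c d : int -> R) (W : nat).

(* The range is half open, -W <= n < W, hence the asymmetric boundary terms below. *)
Definition zsum W g : R := \sum_(0 <= i < W + W) g (i%:Z - W%:Z).

Lemma eq_zsum W g1 g2 : g1 =1 g2 -> zsum W g1 = zsum W g2.
Proof. by move=> e; apply: eq_bigr => i _; rewrite e. Qed.

Lemma zsumD W g1 g2 : zsum W (fun n => g1 n + g2 n) = zsum W g1 + zsum W g2.
Proof. by rewrite /zsum big_split. Qed.

Lemma zsumZ W a g : zsum W (fun n => a * g n) = a * zsum W g.
Proof. by rewrite /zsum mulr_sumr. Qed.

Lemma zsumS W g : zsum W.+1 g = g (- W.+1%:Z) + zsum W g + g W%:Z.
Proof.
rewrite /zsum addnS addSn big_nat_recl // big_nat_recr //= addrA.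
congr (_ + _ + _); first by congr g; lia.
  by rewrite !big_mkord; apply: eq_bigr => i _; congr g; lia.
by congr g; lia.
Qed.

Lemma zsum_widen W1 W2 g : (W1 <= W2)%N ->
  (forall n, (W1 <= `|n|)%N -> g n = 0) -> zsum W2 g = zsum W1 g.
Proof.
move=> /subnKC <- g0; elim: (W2 - W1)%N => [|k IH]; first by rewrite addn0.
by rewrite addnS zsumS IH !g0 ?add0r ?addr0 //; lia.
Qed.

Lemma zsum_shift1 W g : g (- W%:Z) = 0 -> g W%:Z = 0 ->
  zsum W (fun n => g (n + 1)) = zsum W g.
Proof.
move=> g1 g2; case: W g1 g2 => [|W] g1 g2; first by rewrite /zsum !big_geq.
rewrite /zsum addSn big_nat_recr //= [RHS]big_nat_recl //=.
rewrite (_ : (_ + 1)%R = W.+1%:Z); last by lia.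
rewrite (_ : 0%:Z - _ = - W.+1%:Z); last by lia.
rewrite g1 g2 add0r addr0 !big_mkord.
by apply: eq_bigr => i _; congr g; lia.
Qed.

Lemma zsum_shift W0 W k g : (W0 + 2 * `|k| <= W)%N ->
  (forall n, (W0 <= `|n|)%N -> g n = 0) ->
  zsum W (fun n => g (n + k)) = zsum W g.
Proof.
have shiftn (j : nat) g' : (forall n, (W <= `|n| + j)%N -> g' n = 0) ->
    zsum W (fun n => g' (n + j%:Z)) = zsum W g'.
  elim: j g' => [|j IH] g' g0; first by apply: eq_zsum => n; rewrite addr0.
  rewrite -(IH g'); last by move=> n h; apply: g0; lia.
  rewrite -(@zsum_shift1 _ (fun n => g' (n + j%:Z))); last 2 first.
  - by apply: g0; lia.
  - by apply: g0; lia.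
  by apply: eq_zsum => n; congr g'; lia.
case: (intP k) => [|j|j] hW g0.
- by apply: eq_zsum => n; rewrite addr0.
- by apply: shiftn => n h; apply: g0; lia.
- rewrite -(shiftn j.+1 (fun n => g (n + - j.+1%:Z))); last first.
    by move=> n h; apply: g0; lia.
  by apply: eq_zsum => n; congr g; lia.
Qed.

Lemma zsum_opp W g : g (- W%:Z) = 0 -> g W%:Z = 0 ->
  zsum W (fun n => g (- n)) = zsum W g.
Proof.
move=> g1 g2; rewrite -(zsum_shift1 g1 g2) /zsum !big_mkord.
rewrite (reindex_inj rev_ord_inj) /=; apply: eq_bigr => i _; congr g.
by have := ltn_ord i; lia.
Qed.

Lemma zsum_delta W m c : (forall n, (W <= `|n|)%N -> c n = 0) ->
  zsum W (fun n => c n * (n == m)%:R) = c m.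
Proof.
move=> c0; rewrite /zsum big_mkord.
have [mW|mW] := boolP (- W%:Z <= m < W%:Z); last first.
  rewrite c0; last by lia.
  rewrite big1 // => i _; case: eqP => [e|_]; last by rewrite mulr0.
  by move: mW; have := ltn_ord i; lia.
have hi : (absz (m + W%:Z)%R < W + W)%N by lia.
rewrite (bigD1 (Ordinal hi)) //= big1 => [|i ne].
  by rewrite addr0 [_ == m](_ : _ = true) ?mulr1; [congr c; lia|apply/eqP; lia].
case: eqP => [e|_]; last by rewrite mulr0.
by move: ne; rewrite -val_eqE /=; move: e; lia.
Qed.

Definition cosmul (x : R) c : int -> R :=
  fun n => (c (n - 1) + c (n + 1)) / 2 - x * c n.

(* Effect on Fourier coefficients of multiplication by [\prod_(j < K) (cos t - x j)]. *)
Fixpoint cosprod (x : nat -> R) (K : nat) c : int -> R :=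
  if K is k.+1 then cosmul (x k) (cosprod x k c) else c.

Lemma cosprodB x K c d n :
  cosprod x K (fun m => c m - d m) n = cosprod x K c n - cosprod x K d n.
Proof. by elim: K n => [//|K IH] n /=; rewrite /cosmul !IH; ring. Qed.

Lemma cosprod_shift x K s c n :
  cosprod x K (fun m => c (m + s)) n = cosprod x K c (n + s).
Proof.
elim: K n => [//|K IH] n /=; rewrite /cosmul !IH.
by rewrite (addrAC n (-1)) (addrAC n 1).
Qed.

Lemma cosprod_opp x K c n : cosprod x K (fun m => c (- m)) n = cosprod x K c (- n).
Proof.
elim: K n => [//|K IH] n /=; rewrite /cosmul !IH.
by rewrite opprB opprD [1 - n]addrC [cosprod _ _ _ (-n + 1) + _]addrC.
Qed.

Lemma eq_cosprod x K c d : c =1 d -> cosprod x K c =1 cosprod x K d.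
Proof. by move=> e; elim: K => [//|K IH] n /=; rewrite /cosmul !IH. Qed.

(** Each factor cos t - x couples only neighbouring coefficients, so a window of zeros loses one
    place at each end. At its left edge only the contribution of [c n] survives, moving one place
    right and being halved at each step. *)
Lemma cosprod_local x K c n (L : nat) :
  (forall j, n < j <= n + L%:Z -> c j = 0) ->
  (forall j, n + K%:Z < j <= n + L%:Z - K%:Z -> cosprod x K c j = 0) /\
  ((K + K <= L)%N -> cosprod x K c (n + K%:Z) = c n / 2 ^+ K).
Proof.
move=> c0; elim: K => [|K [IH0 IH1]].
  by split=> [j h|_]; [apply: c0; lia|rewrite addr0 divr1].
split=> [j h|h] /=; rewrite /cosmul.
  by rewrite !IH0 ?mulr0 ?addr0 ?subr0 ?mul0r //; lia.
rewrite (IH0 (n + K.+1%:Z)) ?mulr0 ?subr0; last by lia.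
rewrite (IH0 (n + K.+1%:Z + 1)) ?addr0; last by lia.
rewrite (_ : n + K.+1%:Z - 1 = n + K%:Z); last by lia.
by rewrite IH1; [rewrite exprS; field|lia].
Qed.

Lemma cosprod_eq0 x K c W : (forall n, (W <= `|n|)%N -> c n = 0) ->
  forall n, (W + K <= `|n|)%N -> cosprod x K c n = 0.
Proof.
move=> c0; elim: K => [|K IH] n h /=; first by apply: c0; lia.
by rewrite /cosmul !IH ?addr0 ?mulr0 ?subr0 ?mul0r //; lia.
Qed.

Lemma cosprod_gt0 x K c m : (forall n, m < n -> c n = 0) ->
  forall n, m + K%:Z < n -> cosprod x K c n = 0.
Proof.
move=> c0; elim: K => [|K IH] n h /=; first by apply: c0; lia.
by rewrite /cosmul !IH ?addr0 ?mulr0 ?subr0 ?mul0r //; lia.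
Qed.

Lemma zsum_cosprod x K c W0 W (t s : R) : (forall n, (W0 <= `|n|)%N -> c n = 0) ->
  (W0 + K + 2 <= W)%N ->
  zsum W (fun n => cosprod x K c n * cos (n%:~R * t + s)) =
  \prod_(j < K) (cos t - x j) * zsum W (fun n => c n * cos (n%:~R * t + s)).
Proof.
move=> c0; elim: K => [|K IH] hW; first by rewrite big_ord0 mul1r.
rewrite big_ord_recr /= mulrAC -IH; last by lia.
set d := cosprod x K c.
have d0 n : (W0 + K <= `|n|)%N -> d n = 0 by exact: cosprod_eq0.
pose h1 n := d n * cos ((n + 1)%:~R * t + s).
pose h2 n := d n * cos ((n - 1)%:~R * t + s).
transitivity (zsum W (fun n => 2^-1 * h1 (n - 1)) + zsum W (fun n => 2^-1 * h2 (n + 1))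
   + zsum W (fun n => - x K * (d n * cos (n%:~R * t + s)))).
  rewrite -!zsumD; apply: eq_zsum => n; rewrite /cosmul /h1 /h2 subrK addrK.
  by ring.
rewrite !zsumZ (@zsum_shift (W0 + K)) ?(@zsum_shift (W0 + K)); try by lia.
- rewrite -!zsumZ -!zsumD -[RHS]mulrC -zsumZ; apply: eq_zsum => n.
  rewrite /h1 /h2 !intrD !mulrDl !mul1r !mulN1r -!addrA ![_ + s]addrC !addrA.
  by rewrite !(cosD, cosN, sinN); field.
- by move=> n h; rewrite /h2 d0 ?mul0r.
- by move=> n h; rewrite /h1 d0 ?mul0r.
Qed.

End SymmetricSums.

(** * Discrete orthogonality on equally spaced points *)

Section Grid.
Variable R : realType.

Definition grid (M l : nat) : R := l%:R * (2 * pi / M%:R).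

Lemma sin_int_2pi (j : int) (t : R) : sin (t + j%:~R * (2 * pi)) = sin t.
Proof.
have nat_case (n : nat) u : sin (u + n%:R * (2 * pi)) = sin u :> R.
  by rewrite -[RHS](periodicn (@sinD2pi R) n); congr sin;
  rewrite -(mulr_natr (pi *+ 2) n) -(mulr_natr pi 2); ring.
case: (intP j) => [|n|n]; first by rewrite mul0r addr0.
  exact: nat_case.
by rewrite -(nat_case n.+1) -addrA -mulrDl intrN addNr mul0r addr0.
Qed.

Lemma cos_int_2pi (j : int) (t : R) : cos (t + j%:~R * (2 * pi)) = cos t.
Proof. by rewrite -[in LHS]sinDpihalf addrAC sin_int_2pi sinDpihalf. Qed.

(** For nonzero [j], multiplication by the sine of half the step makes the sum telescope; this sine
    is nonzero because 0 < |j| < M. *)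
Lemma sum_cos_grid (M : nat) (j : int) : (`|j| < M)%N ->
  \sum_(l < M) cos (j%:~R * grid M l) = (j == 0)%:R * M%:R :> R.
Proof.
move=> jM; have [->|j0] := eqVneq j 0.
  rewrite mul1r (eq_bigr (fun=> 1)); first by rewrite sumr_const card_ord.
  by move=> l _; rewrite mul0r cos0.
rewrite mul0r.
have M0 : M%:R != 0 :> R by rewrite pnatr_eq0; lia.
wlog jpos : j jM j0 / 0 < j.
  move=> h; have [jp|jn] := ltP 0 j; first exact: h.
  rewrite (eq_bigr (fun l : 'I_M => cos ((- j)%:~R * grid M l))); last first.
    by move=> l _; rewrite intrN mulNr cosN.
  by apply: h; lia.
pose phi : R := j%:~R * (2 * pi / M%:R).
have sinphi : 0 < sin (phi / 2).
  apply: sin_gt0_pi; have M_gt0 : 0 < M%:R :> R by rewrite ltr0n; lia.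
  have -> : phi / 2 = j%:~R / M%:R * pi by rewrite /phi; field.
  apply/andP; split; first by rewrite mulr_gt0 ?divr_gt0 ?pi_gt0 ?ltr0z.
  rewrite -[ltRHS]mul1r ltr_pM2r ?pi_gt0 // ltr_pdivrMr // mul1r.
  by rewrite pmulrn ltr_int; lia.
apply: (mulIf (lt0r_neq0 sinphi)); rewrite mul0r mulr_suml.
have -> : \sum_(l < M) cos (j%:~R * grid M l) * sin (phi / 2) =
    \sum_(0 <= l < M) (sin (l.+1%:R * phi - phi / 2) / 2 - sin (l%:R * phi - phi / 2) / 2).
  rewrite big_mkord; apply: eq_bigr => l _.
  have -> : l.+1%:R * phi - phi / 2 = l%:R * phi + phi / 2 by rewrite -natr1; field.
  have -> : j%:~R * grid M l = l%:R * phi by rewrite /grid /phi; ring.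
  by rewrite !sinD cosN sinN; field.
rewrite telescope_sumr // mul0r sub0r.
have -> : M%:R * phi - phi / 2 = - (phi / 2) + j%:~R * (2 * pi).
  by rewrite /phi; field.
by rewrite sin_int_2pi subrr.
Qed.

Lemma sum_coscos_grid (M : nat) (i j : int) : (`|i| + `|j| < M)%N ->
  \sum_(l < M) cos (i%:~R * grid M l) * cos (j%:~R * grid M l) =
  ((i == - j)%:R + (i == j)%:R) * M%:R / 2 :> R.
Proof.
move=> ijM.
transitivity ((\sum_(l < M) cos ((i + j)%:~R * grid M l)
  + \sum_(l < M) cos ((i - j)%:~R * grid M l)) / 2 : R).
  rewrite -big_split mulr_suml /=; apply: eq_bigr => l _.
  by rewrite !intrD intrN !mulrDl mulNr !cosD cosN sinN; field.
rewrite !sum_cos_grid; try by lia.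
by rewrite addr_eq0 subr_eq0 -mulrDl.
Qed.

(** Averages over a grid finer than all frequencies involved recover the coefficients exactly,
    without integrals. The form at [X] then becomes the average of the nonnegative polynomial times
    the squared modulus of the exponential sum with weights [X]. *)
Lemma psd_coef_nonneg_trig (c : int -> R) (W : nat) :
  (forall n, c (- n) = c n) -> (forall n, (W <= `|n|)%N -> c n = 0) ->
  (forall t, 0 <= zsum W (fun n => c n * cos (n%:~R * t))) -> psd c.
Proof.
move=> c_even c0 F0 X.
pose D := (\max_(p <- X) `|p.2|)%N.
have DX p : p \in X -> (`|p.2| <= D)%N.
  by move=> pX; rewrite /D (big_rem p) //= leq_maxl.
pose M := (W + D + D).+1.
have M0 : 0 < M%:R :> R by rewrite ltr0n.
have coef m : (`|m| <= D + D)%N ->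
    \sum_(l < M) zsum W (fun n => c n * cos (n%:~R * grid M l)) * cos (m%:~R * grid M l)
    = M%:R * c m.
  move=> mD; rewrite /zsum.
  under eq_bigr do rewrite mulr_suml.
  rewrite exchange_big /=.
  transitivity (zsum W (fun n => M%:R / 2 * (c n * (n == - m)%:R + c n * (n == m)%:R))).
    rewrite /zsum !big_nat; apply: eq_bigr => i /andP[_ iW].
    under eq_bigr do rewrite -mulrA.
    rewrite -mulr_sumr sum_coscos_grid; first by ring.
    by rewrite /M; lia.
  by rewrite zsumZ zsumD !zsum_delta // c_even; field.
rewrite -(pmulr_rge0 _ M0).
have -> : M%:R * qform c X X = \sum_(l < M) zsum W (fun n => c n * cos (n%:~R * grid M l)) *
    ((\sum_(p <- X) p.1 * cos (p.2%:~R * grid M l)) ^+ 2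
    + (\sum_(p <- X) p.1 * sin (p.2%:~R * grid M l)) ^+ 2).
  rewrite /qform mulr_sumr big_seq.
  under eq_bigr => p pX.
    rewrite mulr_sumr big_seq.
    under eq_bigr => q qX.
      rewrite mulrCA -coef; last by have := DX _ pX; have := DX _ qX; move: (p.2) (q.2); clear; move=> i j h1 h2; lia.
      rewrite mulr_sumr; over.
    rewrite -big_seq exchange_big /=; over.
  rewrite -big_seq exchange_big /=; apply: eq_bigr => l _.
  move: (zsum _ _) => z.
  rewrite !expr2 !mulr_suml -big_split mulr_sumr /=; apply: eq_bigr => p _.
  rewrite !mulr_sumr -big_split mulr_sumr; apply: eq_bigr => q _ /=.
  by rewrite intrB mulrBl cosB; ring.
by apply: sumr_ge0 => l _; rewrite mulr_ge0 ?F0 // addr_ge0 ?sqr_ge0.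
Qed.

End Grid.

(** * Periodicity of the limit coefficients *)

Section Periodicity.
Variable R : realType.

(* Equality of two windows propagates backwards, so each repetition among T + 1
   consecutive windows, T being the number of windows, yields a period d <= T on
   everything before it; d depends on the place but always divides T!. *)
Lemma backward_determined_periodic (x : nat -> R) (L n0 : nat) :
  (forall n, (n0 <= n)%N -> x n ^+ 2 = 1) ->
  (forall n n', (n0 <= n)%N -> (n0 <= n')%N ->
     (forall j, (0 < j <= L)%N -> x (n + j)%N = x (n' + j)%N) -> x n = x n') ->
  exists2 q : nat, (0 < q)%N & forall n, (n0 <= n)%N -> x (n + q)%N = x n.
Proof.
move=> x1 xdet.
pose w n : {ffun 'I_L -> bool} := [ffun j : 'I_L => x (n + j.+1)%N == 1].
have wE n n' : (n0 <= n)%N -> (n0 <= n')%N -> w n = w n' ->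
    forall j, (0 < j <= L)%N -> x (n + j)%N = x (n' + j)%N.
  move=> hn hn' /ffunP ww [//|j] /= hj; have := ww (Ordinal hj); rewrite !ffunE /=.
  have h1 : x (n + j.+1)%N ^+ 2 = 1 by apply: x1; lia.
  have h2 : x (n' + j.+1)%N ^+ 2 = 1 by apply: x1; lia.
  move/eqP: h1; rewrite sqrf_eq1 => /orP[]/eqP->;
  move/eqP: h2; rewrite sqrf_eq1 => /orP[]/eqP-> //; rewrite eqxx.
    by move/esym/eqP.
  by move/eqP=> ->.
have back k n d : (n0 <= n)%N -> w (n + k)%N = w (n + k + d)%N -> x n = x (n + d)%N.
  elim: k n d => [|k IH] n d hn.
    rewrite addn0 => ww; apply: xdet => //; first by lia.
    by move=> j hj; apply: wE => //; lia.
  move=> ww; apply: IH => //; apply/ffunP => j; rewrite !ffunE; congr (_ == _).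
  case: j => -[|j] hj /=.
    have := xdet (n + k.+1)%N (n + k.+1 + d)%N.
    rewrite (_ : n + k.+1 + d = n + k + d + 1)%N; last by lia.
    rewrite (_ : n + k.+1 = n + k + 1)%N; last by lia.
    move=> ->; [by []|lia|lia|].
    rewrite (_ : n + k + d + 1 = n + k.+1 + d)%N; last by lia.
    rewrite (_ : n + k + 1 = n + k.+1)%N; last by lia.
    by move=> j hj'; apply: wE => //; lia.
  have := @wE (n + k.+1)%N (n + k.+1 + d)%N _ _ ww j.+1.
  rewrite (_ : n + k.+1 + j.+1 = n + k + j.+2)%N; last by lia.
  rewrite (_ : n + k.+1 + d + j.+1 = n + k + d + j.+2)%N; last by lia.
  by move=> ->; [by []|lia|lia|lia].
pose T := #|{: {ffun 'I_L -> bool}}|.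
have period m : exists d, [/\ (0 < d)%N, (d <= T)%N &
    forall n, (n0 <= n <= m)%N -> x (n + d)%N = x n].
  have : ~~ injectiveb (fun i : 'I_T.+1 => w (m + i)%N).
    by apply/injectiveP => /leq_card; rewrite card_ord ltnn.
  case/injectivePn => i [j]; wlog ij : i j / (i < j)%N.
    move=> h ne e; have [l|g|/val_inj e'] := ltngtP i j; first exact: (h i j).
      by apply: (h j i) => //; rewrite eq_sym.
    by rewrite e' eqxx in ne.
  move=> _ ww; exists (j - i)%N; split; [lia|have := ltn_ord j; lia|].
  move=> n hn; symmetry; apply: (@back (m + i - n)%N); first by lia.
  rewrite (_ : n + (m + i - n) = m + i)%N; last by lia.
  by rewrite ww; congr w; lia.
exists T`!; first exact: fact_gt0.
move=> n hn; have [d [d0 dT dper]] := period (n + T`!)%N.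
have iter_d l : (l * d <= T`!)%N -> x (n + l * d)%N = x n.
  elim: l => [|l IH] hl; first by rewrite addn0.
  rewrite mulSn (addnC d) addnA dper; first by apply: IH; lia.
  by lia.
have /dvdnP[k kE] : (d %| T`!)%N by rewrite dvdn_fact // d0.
by rewrite {1}kE iter_d // kE.
Qed.

(** [cosprod_local] applied to the difference of two translates of [c]: after equal windows, a
    discrepancy just before them remains visible K places to the right. *)
Lemma cosprod_window (x : nat -> R) K (c : int -> R) (n n' : int) (L : nat) :
  (forall j : nat, (0 < j <= L)%N -> c (n + j%:Z) = c (n' + j%:Z)) ->
  (forall j, K%:Z < j <= L%:Z - K%:Z ->
     cosprod x K c (n + j) = cosprod x K c (n' + j)) /\
  ((K + K <= L)%N ->
     cosprod x K c (n + K%:Z) - cosprod x K c (n' + K%:Z) = (c n - c n') / 2 ^+ K).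
Proof.
move=> cc; pose d m := c (m + n) - c (m + n').
have d0 j : 0 < j <= 0 + L%:Z -> d j = 0.
  move=> hj; rewrite /d; have := cc `|j|%N.
  rewrite (_ : `|j|%N%:Z = j); last by lia.
  by rewrite ![j + _]addrC => -> ; [rewrite subrr|lia].
have dE j : cosprod x K d j = cosprod x K c (n + j) - cosprod x K c (n' + j).
  by rewrite /d cosprodB !cosprod_shift ![j + _]addrC.
have [h1 h2] := @cosprod_local R x K d 0 L d0; split=> [j hj|hL].
  by apply/eqP; rewrite -subr_eq0 -dE h1 //; lia.
by rewrite -dE -[K%:Z]add0r h2 // /d !add0r.
Qed.
End Periodicity.

Section LimitPeriodicity.
Variables (R : realType) (C : int * int -> R) (x : nat -> R) (K : nat).
Hypothesis evenC : forall g, C (- g) = C g.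
Hypothesis psdC : psd C.

Let e (n : int) : seq (R * (int * int)) := [:: (1, (0, n))].

Let qform_e (X : seq (R * (int * int))) n :
  qform C X (e n) = \sum_(p <- X) p.1 * C (p.2.1, p.2.2 - n).
Proof.
rewrite /qform; apply: eq_bigr => -[w [i j]] _; rewrite big_seq1 /= mulr1.
by congr (_ * C (_, _)); rewrite subr0.
Qed.

Let height (X : seq (R * (int * int))) : nat := (\max_(p <- X) `|p.2.2|)%N.

Let le_height X p : p \in X -> (`|p.2.2| <= height X)%N.
Proof. by move=> pX; rewrite /height (big_rem p) //= leq_maxl. Qed.

Let sqr_sub_sqr1 (a b : R) : a ^+ 2 = 1 -> b ^+ 2 = 1 -> a <> b -> (a - b) ^+ 2 = 4.
Proof.
move=> /eqP; rewrite sqrf_eq1 => /orP[]/eqP->;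
move=> /eqP; rewrite sqrf_eq1 => /orP[]/eqP-> // _; ring.
Qed.

(* If two windows of a agree but the entries before them differ, then e_s - e_s',
   with s and s' the two matching indices, is orthogonal to e_j for -J < j < 0 but
   not to e_0. This contradicts near_orth_tail for e_0 minus its projection. *)
Lemma central_periodic (a : int -> R) :
  (forall n, C (0, n) = cosprod x K a n) -> (forall n : nat, (0 < n)%N -> a n%:Z ^+ 2 = 1) ->
  exists2 q : nat, (0 < q)%N &
  exists n1 : nat, forall n : nat, (n1 <= n)%N -> a (n + q)%N%:Z = a n%:Z.
Proof.
move=> Ca a1; have [B B0 tail] := near_orth_tail evenC psdC.
have K0 : 0 < 4 ^+ K :> R by rewrite exprn_gt0.
(* Two tail values with squares at most [eps * B] differ by at most 2 / 4^K in square, whereas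
   unequal signs would force 4 / 4^K. *)
pose eps : R := (2 * B * 4 ^+ K)^-1.
have eps0 : 0 < eps by rewrite invr_gt0 !mulr_gt0.
have [Y Y0 Yorth] := near_projection evenC psdC (past 0) (e 0) eps0.
have Y1 : supp_in (past 1) (e 0 ++ Y).
  apply/andP; split; first by [].
  by apply: sub_all Y0 => -[w [i j]]; rewrite /past /= => /andP[-> /=]; clear; lia.
have [n0 hn0] := tail _ _ _ eps0 Y1 Yorth.
(* Each multiplication by a factor costs one place at both ends of the window, and [height Y] covers
   all indices occurring in the projection. *)
pose L := (K + K + height Y)%N.
have [||q q0 hq] := @backward_determined_periodic R (fun n => a n%:Z) L n0.+1.
- by move=> n hn; apply: a1; lia.
- move=> n n' hn hn' win; apply/eqP/negP => /negP/eqP ne.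
  have [win1 win2] := @cosprod_window R x K a n%:Z n'%:Z L win.
  have dn : qform C (e 0 ++ Y) (e (n + K)%N%:Z) - qform C (e 0 ++ Y) (e (n' + K)%N%:Z)
      = (a n%:Z - a n'%:Z) / 2 ^+ K.
    rewrite -win2; last by rewrite /L; lia.
    rewrite !qform_e -sumrB big_cat /= big_seq1 /= !sub0r !mul1r.
    rewrite [X in _ + X]big1_seq ?addr0; last first.
      move=> [w [i j]] /= pY; have /= := le_height pY.
      have /allP/(_ _ pY)/andP[/= /eqP -> j0] := Y0 => jY.
      rewrite -[C (0, j - (n + K)%N%:Z)]evenC -[C (0, j - (n' + K)%N%:Z)]evenC.
      rewrite (_ : - (0, _) = (0, n%:Z + (K%:Z - j))); last first.
        by congr (_, _); rewrite ?oppr0 //=; lia.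
      rewrite (_ : - (0, _) = (0, n'%:Z + (K%:Z - j))); last first.
        by congr (_, _); rewrite ?oppr0 //=; lia.
      rewrite !Ca win1 ?subrr //; rewrite /L; lia.
    rewrite -[C (0, - (n + K)%N%:Z)]evenC -[C (0, - (n' + K)%N%:Z)]evenC.
    rewrite (_ : - (0, _) = (0, n%:Z + K%:Z)); last first.
      by congr (_, _); rewrite ?oppr0 //=; lia.
    rewrite (_ : - (0, _) = (0, n'%:Z + K%:Z)); last first.
      by congr (_, _); rewrite ?oppr0 //=; lia.
    by rewrite !Ca.
  have := sqr_sub_sqr1 (a1 n _) (a1 n' _) ne.
  have /(congr1 (fun u => u ^+ 2)) := dn.
  rewrite expr_div_n -exprM mulnC exprM (_ : 2 ^+ 2 = 4); last by ring.
  have h1 := hn0 (n + K)%N ltac:(lia); have h2 := hn0 (n' + K)%N ltac:(lia).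
  move: h1 h2; have -> : eps * B = (2 * 4 ^+ K)^-1 by rewrite /eps; field; lra.
  move: (qform _ _ _) (qform _ _ _) => u v h1 h2 uv.
  move=> /(_ ltac:(lia) ltac:(lia)) h4; move: uv; rewrite h4.
  have : (u - v) ^+ 2 <= 2 * u ^+ 2 + 2 * v ^+ 2.
    by rewrite -subr_ge0 (_ : _ - _ = (u + v) ^+ 2) ?sqr_ge0 //; ring.
  have : 0 < (4 ^+ K)^-1 :> R by rewrite invr_gt0.
  by move: h1 h2; rewrite invfM; lra.
by exists q => //; exists n0.+1.
Qed.

(* e_(1, K) is orthogonal to all e_(0, j) with j < 0, and so, nearly, is its
   near-projection on the span of all e_(0, j), to which near_orth_tail applies. *)
Lemma top_tail_cvg0 (v : int -> R) (eps : R) : (forall n, C (1, n) = v n) ->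
  (forall n, K%:Z < n -> v n = 0) -> 0 < eps ->
  exists n1 : nat, forall n : nat, (n1 <= n)%N -> v (K%:Z - n%:Z) ^+ 2 <= eps.
Proof.
move=> Cv v0 eps0; have [B B0 tail] := near_orth_tail evenC psdC.
pose u0 := qform C (e 0) (e 0).
have u0_ge0 : 0 <= u0 by exact: psdC.
have een n : qform C (e n) (e n) = u0.
  by rewrite /u0 !qform_e !big_seq1 /= !subrr.
pose d := eps / (2 * (u0 + B)).
have d0 : 0 < d by rewrite divr_gt0 //; lra.
pose X : seq (R * (int * int)) := [:: (1, (1, K%:Z))].
have [Y Y0 Yorth] := near_projection evenC psdC (fun g => g.1 == 0) X d0.
have YM : supp_in (past (height Y).+1%:Z) Y.
  apply/allP => -[w [i j]] pY; have /= := le_height pY.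
  by have /allP/(_ _ pY)/= := Y0; rewrite /past /= => -> /=; clear; lia.
(* [X] is exactly orthogonal to the past, since C (1, K - j) vanishes for j < 0; so [Y] inherits the
   near-orthogonality of [X ++ Y]. *)
have Ypast : near_orth C d (past 0) Y.
  move=> Z Z0; have -> : qform C Y Z = qform C (X ++ Y) Z.
    rewrite qform_catl [qform C X Z](_ : _ = 0) ?add0r //.
    rewrite /qform big_seq1 big1_seq // => -[w [i j]] /= pZ.
    have /allP/(_ _ pZ)/andP[/= /eqP -> j0] := Z0.
    rewrite (_ : (1, K%:Z) - (0, j) = (1, K%:Z - j)); last first.
      by congr (_, _) => /=; rewrite subr0.
    by rewrite Cv v0 ?mulr0 //; move: j0; clear; lia.
  by apply: Yorth; apply: sub_all Z0 => p /andP[].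
have [n0 hn0] := tail _ _ _ d0 YM Ypast.
exists n0 => n hn; have h1 := hn0 n hn.
have := Yorth (e n%:Z) isT; rewrite qform_catl een.
have -> : qform C X (e n%:Z) = v (K%:Z - n%:Z).
  by rewrite qform_e big_seq1 /= mul1r Cv.
have : d * u0 + d * B = eps / 2 by rewrite /d; field; lra.
move: h1; move: (qform _ _ _) (v _) => y z.
have : 0 <= (z + 2 * y) ^+ 2 by rewrite sqr_ge0.
have -> : (z + 2 * y) ^+ 2 = 2 * (z + y) ^+ 2 + 2 * y ^+ 2 - z ^+ 2 by ring.
by move: (d * u0) (d * B) => ? ?; lra.
Qed.

(** Read backwards, [t] is determined by its windows: equal windows preceded by different signs
    would make two coefficients of the product differ by 2 / 2^K in modulus, but far down both are
    small by [top_tail_cvg0]. *)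
Lemma top_periodic (t : int -> R) :
  (forall n, C (1, n) = cosprod x K t n) -> (forall n, 0 < n -> t n = 0) ->
  (forall n, n <= 0 -> t n ^+ 2 = 1) ->
  exists2 q : nat, (0 < q)%N &
  exists n1 : nat, forall n : nat, (n1 <= n)%N -> t (- (n + q)%N%:Z) = t (- n%:Z).
Proof.
move=> Ct t0 t1.
have K0 : 0 < 4 ^+ K :> R by rewrite exprn_gt0.
have eps0 : 0 < (2 * 4 ^+ K)^-1 :> R by rewrite invr_gt0 mulr_gt0.
have v0 n : K%:Z < n -> cosprod x K t n = 0.
  by move=> h; apply: (cosprod_gt0 _ t0); rewrite add0r.
have [n0 hn0] := top_tail_cvg0 Ct v0 eps0.
pose b n := t (- n).
have [||q q0 hq] := @backward_determined_periodic R (fun n => b n%:Z) (K + K) n0.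
- by move=> n hn; apply: t1; lia.
- move=> n n' hn hn' win; apply/eqP/negP => /negP/eqP ne.
  have [_] := @cosprod_window R x K b n%:Z n'%:Z (K + K) win.
  rewrite /b !(@cosprod_opp R x K t) => /(_ (leqnn _)).
  have := sqr_sub_sqr1 (t1 (- n%:Z) _) (t1 (- n'%:Z) _) ne.
  have h1 := hn0 (n + K + K)%N ltac:(lia); have h2 := hn0 (n' + K + K)%N ltac:(lia).
  move: h1 h2.
  rewrite (_ : K%:Z - (n + K + K)%N%:Z = - (n%:Z + K%:Z)); last by lia.
  rewrite (_ : K%:Z - (n' + K + K)%N%:Z = - (n'%:Z + K%:Z)); last by lia.
  move: (cosprod _ _ _ _) (cosprod _ _ _ _) => v u h1 h2.
  move=> /(_ ltac:(lia) ltac:(lia)) h4 /(congr1 (fun u => u ^+ 2)).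
  rewrite expr_div_n -exprM mulnC exprM (_ : 2 ^+ 2 = 4); last by ring.
  rewrite h4 => uv.
  have : (u - v) ^+ 2 <= 2 * u ^+ 2 + 2 * v ^+ 2.
    by rewrite -subr_ge0 (_ : _ - _ = (u + v) ^+ 2) ?sqr_ge0 //; ring.
  have : 0 < (4 ^+ K)^-1 :> R by rewrite invr_gt0.
  by move: h1 h2; rewrite invfM uv; lra.
by exists q => //; exists n0.
Qed.

End LimitPeriodicity.

(** * The inequality between the two limits *)

Section Fejer.
Variable R : realType.

(** The double sum is T times a Fejer mean. Beyond the support of [g] it is affine in T with slope
    [zsum W g], so a negative slope would eventually make it negative. *)
Lemma zsum_ge0_fejer (g : int -> R) (W : nat) : (forall n, (W <= `|n|)%N -> g n = 0) ->
  (forall T, 0 <= \sum_(i < T) \sum_(j < T) g (i%:Z - j%:Z)) -> 0 <= zsum W g.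
Proof.
move=> g0; pose s T := \sum_(i < T) \sum_(j < T) g (i%:Z - j%:Z).
rewrite -/(forall T, 0 <= s T) => s_ge0.
have sS T : (W <= T)%N -> s T.+1 = s T + zsum W g.
  move=> WT; rewrite -(zsum_widen WT g0) /s big_ord_recr /= big_ord_recr /= subrr.
  under eq_bigr do rewrite big_ord_recr /=.
  rewrite big_split /= -!addrA; congr (_ + _).
  rewrite /zsum (@big_cat_nat _ _ _ T) //=; last by lia.
  rewrite !big_mkord -[X in _ = _ + \sum_(X <= _ < _) _]add0n big_addn addnK big_mkord.
  congr (_ + _).
  rewrite [RHS](eq_bigr (fun i : 'I_T => g i%:Z)); last by move=> i _; congr g; lia.
  have gT : g T%:Z = 0 by apply: g0; lia.
  transitivity (\sum_(i < T.+1) g i%:Z); last by rewrite big_ord_recr /= gT addr0.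
  rewrite big_ord_recl addrC; congr (_ + _).
  rewrite (reindex_inj rev_ord_inj) /=; apply: eq_bigr => i _; congr g.
  by have := ltn_ord i; rewrite /bump /=; lia.
have sk k : s (W + k)%N = s W + zsum W g *+ k.
  elim: k => [|k IH]; first by rewrite addn0 addr0.
  by rewrite addnS sS ?IH ?mulrSr ?addrA //; lia.
rewrite leNgt; apply/negP => z0.
have z1 : 0 < - zsum W g by rewrite oppr_gt0.
have := archi_boundP (divr_ge0 (s_ge0 W) (ltW z1)).
set k := Num.bound _; rewrite ltr_pdivrMr // => hk.
have := s_ge0 (W + k)%N; rewrite sk -mulr_natl.
by lra.
Qed.

(** This is the Fourier series of [C] at the point (s, t), the summands being d = 0, 1, -1. Testing
    positivity with cosine and sine weights on a rectangle gives the Fejer means, and the limit is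
    taken in one variable after the other. *)
Lemma psd_block_ge0 (C : int * int -> R) (W : nat) (s t : R) : psd C ->
  (forall d n, (2 <= `|d|)%N || (W <= `|n|)%N -> C (d, n) = 0) ->
  0 <= zsum W (fun n => C (0, n) * cos (n%:~R * t))
     + zsum W (fun n => C (1, n) * cos (n%:~R * t + s))
     + zsum W (fun n => C (-1, n) * cos (n%:~R * t - s)).
Proof.
move=> psdC C0.
pose f d n := C (d, n) * cos (n%:~R * t + d%:~R * s).
have f_ge0 D T : 0 <= \sum_(k < T) \sum_(l < T) \sum_(i < D) \sum_(j < D)
    f (i%:Z - j%:Z) (k%:Z - l%:Z).
  pose X (h : R -> R) := [seq (h (k%:R * t + i%:R * s), (i%:Z, k%:Z)) |
    k <- iota 0 T, i <- iota 0 D].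
  have sumX (F : R * (int * int) -> R) h : \sum_(p <- X h) F p =
      \sum_(k < T) \sum_(i < D) F (h (k%:R * t + i%:R * s), (i%:Z, k%:Z)).
    rewrite big_allpairs_dep /= -{1}[T]subn0 big_mkord.
    by apply: eq_bigr => k _; rewrite -{1}[D]subn0 big_mkord.
  have := addr_ge0 (psdC (X (@cos R))) (psdC (X (@sin R))).
  rewrite /qform !sumX /= -big_split /=; congr (_ <= _); apply: eq_bigr => k _.
  rewrite [RHS]exchange_big -big_split /=; apply: eq_bigr => i _.
  rewrite !sumX -big_split; apply: eq_bigr => j _.
  rewrite -big_split; apply: eq_bigr => l _ /=.
  rewrite /f -mulrDl mulrC; congr (_ * _).
  by rewrite !intrB !mulrBl addrACA -opprD cosB.
have fW d n : (W <= `|n|)%N -> f d n = 0.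
  by move=> h; rewrite /f C0 ?mul0r // h orbT.
have zf_ge0 D : 0 <= \sum_(i < D) \sum_(j < D) zsum W (f (i%:Z - j%:Z)).
  have -> : \sum_(i < D) \sum_(j < D) zsum W (f (i%:Z - j%:Z)) =
      zsum W (fun n => \sum_(i < D) \sum_(j < D) f (i%:Z - j%:Z) n).
    rewrite /zsum [RHS]exchange_big; apply: eq_bigr => i _ /=.
    by rewrite exchange_big.
  apply: zsum_ge0_fejer => [n h|T]; last exact: f_ge0.
  by rewrite big1 // => i _; rewrite big1 // => j _; rewrite fW.
have := @zsum_ge0_fejer (fun d => zsum W (f d)) 2 _ zf_ge0.
rewrite [zsum 2 _]/zsum !big_nat_recr //= big_geq // add0r.
have f2 d : (2 <= `|d|)%N -> zsum W (f d) = 0.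
  move=> h; rewrite /zsum big1 // => i _; rewrite /f C0 ?mul0r // h //.
move=> /(_ f2); rewrite [X in X + _ + _ + _]f2 // add0r.
congr (_ <= _); rewrite -addrA addrC; congr (_ + _ + _); apply: eq_zsum => n; rewrite /f.
- by rewrite mul0r addr0.
- by rewrite mul1r.
- by rewrite mulN1r.
Qed.

End Fejer.

(** * Trigonometric inequalities, telescoping and Parseval *)

Section Trigonometry.
Variable R : realType.

(** The phase with (cos s, sin s) proportional to (-b, c) minimises the expression, with minimum a -
    sqrt (b^2 + c^2). *)
Lemma sqr_le_of_rotation (a b c : R) :
  (forall s, 0 <= a + (b * cos s - c * sin s)) -> b ^+ 2 + c ^+ 2 <= a ^+ 2.
Proof.
move=> h; pose rho := Num.sqrt (b ^+ 2 + c ^+ 2).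
have bc0 : 0 <= b ^+ 2 + c ^+ 2 by rewrite addr_ge0 ?sqr_ge0.
have rho2 : rho ^+ 2 = b ^+ 2 + c ^+ 2 by rewrite sqr_sqrtr.
have rho0 : 0 <= rho by exact: sqrtr_ge0.
have [r0|rn0] := eqVneq rho 0; first by rewrite -rho2 r0 expr0n sqr_ge0.
have rp : 0 < rho by rewrite lt_neqAle eq_sym rn0.
have unit_circle : (- b / rho) ^+ 2 + (c / rho) ^+ 2 = 1.
  by rewrite !expr_div_n sqrrN -mulrDl -rho2 divff // expf_neq0.
have bI : -1 <= - b / rho <= 1.
  have : (- b / rho) ^+ 2 <= 1 by rewrite -unit_circle lerDl sqr_ge0.
  by move=> ?; apply/andP; split; nra.
have [s [cs ss]] : exists s, cos s = - b / rho /\ sin s = c / rho.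
  pose u := acos (- b / rho).
  have cu : cos u = - b / rho by rewrite acosK // in_itv.
  have : (sin u - c / rho) * (sin u + c / rho) = 0.
    rewrite -subr_sqr; have := cos2Dsin2 u; rewrite cu.
    by move: unit_circle => <-; lra.
  move/eqP; rewrite mulf_eq0 subr_eq0 addr_eq0 => /orP[]/eqP su; first by exists u.
  by exists (- u); rewrite cosN sinN su opprK.
have := h s; rewrite cs ss.
rewrite (_ : b * _ - _ = - rho); last first.
  have -> : b * (- b / rho) - c * (c / rho) = - ((b ^+ 2 + c ^+ 2) / rho) by ring.
  by rewrite -rho2 expr2 mulfK.
by rewrite subr_ge0 -rho2 => ra; rewrite !expr2 ler_pM.
Qed.

(* The values of cos at u - y, u and u + y cannot all coincide for 0 < y < pi. *)
Lemma ge0_of_mul_sqr_cos (h : R -> R) (r : nat) (x : R) : (0 < r)%N -> continuous h ->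
  (forall t, 0 <= h t * (cos (r%:R * t) - x) ^+ 2) -> forall t, 0 <= h t.
Proof.
move=> r0 hc hx t; rewrite leNgt; apply/negP => ht.
have : \forall u \near t, h u < 0.
  exact: (cvgr_lt _ (hc t)).
move=> /nbhs_ballP[d /= d0 hd].
have cosx u : ball t d u -> cos (r%:R * u) = x.
  move=> /hd hu; have := hx u; rewrite nmulr_rge0 // => le0.
  have : (cos (r%:R * u) - x) ^+ 2 == 0 by rewrite eq_le le0 sqr_ge0.
  by rewrite sqrf_eq0 subr_eq0 => /eqP.
have rR : 0 < r%:R :> R by rewrite ltr0n.
pose y := Num.min (d / 2) r%:R^-1.
have y0 : 0 < y by rewrite lt_min invr_gt0 rR divr_gt0.
have yd : y < d by rewrite gt_min; apply/orP; left; lra.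
have yr : r%:R * y <= 1.
  by rewrite mulrC -ler_pdivlMr // mul1r ge_min lexx orbT.
have c0 : cos (r%:R * t) = x by apply: cosx; exact: ballxx.
have c1 : cos (r%:R * t + r%:R * y) = x.
  rewrite -mulrDr; apply: cosx; rewrite /ball /= opprD addrA subrr add0r normrN.
  by rewrite gtr0_norm.
have c2 : cos (r%:R * t - r%:R * y) = x.
  rewrite -mulrBr; apply: cosx; rewrite /ball /= opprB addrCA subrr addr0.
  by rewrite gtr0_norm.
have S0 : 0 < sin (r%:R * y).
  apply: sin_gt0_pi; rewrite mulr_gt0 //=; apply: le_lt_trans yr _.
  by apply: lt_le_trans (pi_ge2 R); lra.
move: c1 c2 (cos2Dsin2 (r%:R * t)) (cos2Dsin2 (r%:R * y)); rewrite cosD cosB -c0.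
move: S0; move: (cos _) (cos _) (sin _) (sin _) => C c s S.
move=> S0 h1 h2 cs CS.
have /eqP : s * S = 0 by lra.
rewrite mulf_eq0 (gt_eqF S0) orbF => /eqP s0.
have cC : c * C = c by lra.
have C1 : C = 1.
  rewrite -[C]mul1r -cs s0 expr0n addr0 expr2 -mulrA cC -expr2.
  by move: cs; rewrite s0 expr0n addr0.
by move: CS (exprn_gt0 2 S0); rewrite C1 expr1n; lra.
Qed.

Lemma ge0_of_mul_cosprod (h : R -> R) (x : nat -> R) (K : nat) : continuous h ->
  (forall t, 0 <= h t * (\prod_(j < K) (cos t - x j)) ^+ 2) -> forall t, 0 <= h t.
Proof.
elim: K h => [|K IH] h hc hx.
  by move=> t; have := hx t; rewrite big_ord0 expr1n mulr1.
apply: (@ge0_of_mul_sqr_cos _ 1 (x K)) => // t; rewrite mul1r; move: t.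
apply: (IH (fun t => h t * (cos t - x K) ^+ 2)) => t.
  have cK : (fun u => cos u - x K) @ t --> cos t - x K.
    by apply: cvgB; [exact: continuous_cos|exact: cvg_cst].
  by apply: (cvgM (hc t)); exact: (cvgM cK cK).
by have := hx t; rewrite big_ord_recr /= exprMn mulrA mulrAC.
Qed.

(** Against a q-periodic weight the differences telescope, leaving one block of length q at each
    end. The range is a multiple of q, so both blocks carry the same weights. *)
Lemma zsum_telescope (c f : int -> R) (q m : nat) : (forall n, f (n + q%:Z) = f n) ->
  zsum (q * m) (fun n => (c n - c (n - q%:Z)) * f n) =
  \sum_(r < q) (c ((q * m)%N%:Z - q%:Z + r%:Z) - c (- (q * m)%N%:Z - q%:Z + r%:Z)) * f r%:Z.
Proof.
move=> fq.
have fqk k n : f (n + (q * k)%N%:Z) = f n.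
  elim: k => [|k IH]; first by rewrite muln0 addr0.
  by rewrite mulnS PoszD addrCA addrC fq.
pose y (i : nat) := c (i%:Z - (q * m)%N%:Z - q%:Z) * f (i%:Z - (q * m)%N%:Z - q%:Z).
have tel M : \sum_(0 <= i < M) (y (i + q)%N - y i) = \sum_(r < q) (y (M + r)%N - y r).
  elim: M => [|M IH]; first by rewrite big_geq // big1 // => r _; rewrite subrr.
  have -> : \sum_(r < q) (y (M.+1 + r)%N - y r) = \sum_(r < q) (y (M + r)%N - y r)
      + \sum_(r < q) (y (M + r.+1)%N - y (M + r)%N).
    by rewrite -big_split; apply: eq_bigr => r _; rewrite addSnnS /=; ring.
  rewrite -(big_mkord xpredT (fun r => y (M + r.+1)%N - y (M + r)%N)).
  by rewrite (@telescope_sumr _ 0 q (fun r => y (M + r)%N)) // addn0 big_nat_recr //= IH.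
rewrite /zsum.
under eq_bigr => i _.
  have -> : (c (i%:Z - (q * m)%N%:Z) - c (i%:Z - (q * m)%N%:Z - q%:Z)) * f (i%:Z - (q * m)%N%:Z)
      = y (i + q)%N - y i.
    rewrite /y -[in X in _ - _ * X](fq) subrK mulrBl; congr (_ * _ - _); first by congr c; lia.
    by congr f; lia.
  over.
rewrite tel; apply: eq_bigr => r _; rewrite /y mulrBl; congr (_ * _ - _ * _).
- by congr c; lia.
- rewrite -[RHS](fqk m) -[LHS]fq; congr f; lia.
- by congr c; lia.
- by rewrite -[LHS]fq -(fqk m); congr f; lia.
Qed.

(** Expanding the squares gives cosines of multiples r - u of the grid angle, and the sum over the
    grid kills all terms off the diagonal. *)
Lemma parseval_grid (q : nat) (D : 'I_q -> R) :
  \sum_(l < q) ((\sum_(r < q) D r * cos (r%:R * grid R q l)) ^+ 2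
              + (\sum_(r < q) D r * sin (r%:R * grid R q l)) ^+ 2)
  = q%:R * \sum_(r < q) D r ^+ 2.
Proof.
transitivity (\sum_(l < q) \sum_(r < q) \sum_(u < q)
    D r * D u * cos ((r%:Z - u%:Z)%:~R * grid R q l)).
  apply: eq_bigr => l _; rewrite !expr2 !mulr_suml -big_split; apply: eq_bigr => r _ /=.
  rewrite !mulr_sumr -big_split; apply: eq_bigr => u _ /=.
  by rewrite intrB mulrBl cosB; ring.
rewrite exchange_big mulr_sumr; apply: eq_bigr => r _ /=.
rewrite exchange_big (bigD1 r) //= [X in _ + X]big1 ?addr0 => [|u ur].
  by rewrite -mulr_sumr sum_cos_grid ?subrr ?eqxx ?mul1r; [ring|have := ltn_ord r; lia].
rewrite -mulr_sumr sum_cos_grid; last by have := ltn_ord r; have := ltn_ord u; lia.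
rewrite subr_eq0; move: ur; rewrite -val_eqE /= eqz_nat eq_sym => /negbTE->.
by rewrite mul0r mulr0.
Qed.

End Trigonometry.

(** * Finite differences and their transforms *)

Section LimitContradiction.
Variable R : realType.
Implicit Types (c : int -> R) (W : nat) (t : R).

(** [zcos] and [zsin] are the real and imaginary parts of the sum of c_n e^{int}. *)
Definition zcos W c t : R := zsum W (fun n => c n * cos (n%:~R * t)).
Definition zsin W c t : R := zsum W (fun n => c n * sin (n%:~R * t)).

Lemma zcos_continuous W c : continuous (zcos W c).
Proof.
move=> t; apply: (cvg_big add_continuous) => i _.
apply: cvgM; first exact: cvg_cst.
apply: (@cvg_comp _ _ _ (fun u => (i%:Z - W%:Z)%:~R * u) (@cos R)); last exact: continuous_cos.
by apply: cvgM; [exact: cvg_cst|exact: cvg_id].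
Qed.

Lemma zsin_continuous W c : continuous (zsin W c).
Proof.
move=> t; apply: (cvg_big add_continuous) => i _.
apply: cvgM; first exact: cvg_cst.
apply: (@cvg_comp _ _ _ (fun u => (i%:Z - W%:Z)%:~R * u) (@sin R)); last exact: continuous_sin.
by apply: cvgM; [exact: cvg_cst|exact: cvg_id].
Qed.

Lemma zsum_cosD W c t s : zsum W (fun n => c n * cos (n%:~R * t + s)) =
  zcos W c t * cos s - zsin W c t * sin s.
Proof.
rewrite mulrC -[X in _ - X]mulrC -mulNr -!zsumZ -zsumD; apply: eq_zsum => n.
by rewrite cosD; ring.
Qed.

Section Difference.
Variables (c : int -> R) (W0 W q : nat).
Hypothesis c0 : forall n, (W0 <= `|n|)%N -> c n = 0.
Hypothesis hW : (W0 + q + 2 * q <= W)%N.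

Let d n := c n - c (n + q%:Z).

Let zsum_d (f : R -> R) t : zsum W (fun n => d n * f (n%:~R * t)) =
  zsum W (fun n => c n * f (n%:~R * t)) - zsum W (fun n => c n * f (n%:~R * t - q%:R * t)).
Proof.
rewrite -[X in _ - X](@zsum_shift _ (W0 + q) _ q%:Z); last 2 first.
- by lia.
- by move=> n h; rewrite c0 ?mul0r //; lia.
rewrite -mulN1r -zsumZ -zsumD; apply: eq_zsum => n.
by rewrite /d intrD -pmulrn (mulrDl n%:~R) addrK; ring.
Qed.

Lemma zcos_difference t :
  zcos W d t = zcos W c t * (1 - cos (q%:R * t)) - zsin W c t * sin (q%:R * t).
Proof.
rewrite /zcos zsum_d zsum_cosD cosN sinN -/(zcos W c t); ring.
Qed.

Lemma zsin_difference t :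
  zsin W d t = zsin W c t * (1 - cos (q%:R * t)) + zcos W c t * sin (q%:R * t).
Proof.
rewrite /zsin zsum_d -/(zsin W c t).
rewrite (@eq_zsum _ _ _ (fun n => c n * cos (n%:~R * t + (- (q%:R * t) - pi / 2)))).
  rewrite zsum_cosD cosB sinB sin_pihalf cos_pihalf cosN sinN; ring.
by move=> n; rewrite addrA cosBpihalf.
Qed.

(** The difference multiplies the transform by 1 - e^{-iqt}, whose squared modulus is 2 (1 - cos (q
    t)). *)
Lemma sqr_difference t : zcos W d t ^+ 2 + zsin W d t ^+ 2 =
  2 * (1 - cos (q%:R * t)) * (zcos W c t ^+ 2 + zsin W c t ^+ 2).
Proof.
rewrite zcos_difference zsin_difference.
have : sin (q%:R * t) ^+ 2 = 1 - cos (q%:R * t) ^+ 2 by have := cos2Dsin2 (q%:R * t); lra.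
move: (cos _) (sin _) (zcos _ _ _) (zsin _ _ _) => C S A B hS.
have -> : (A * (1 - C) - B * S) ^+ 2 + (B * (1 - C) + A * S) ^+ 2
   = (A ^+ 2 + B ^+ 2) * ((1 - C) ^+ 2 + S ^+ 2) by ring.
by rewrite hS; ring.
Qed.

End Difference.

Lemma cosprod_second_difference (x : nat -> R) K c (s n : int) :
  cosprod x K (fun n => (c n - c (n - s)) - (c (n + s) - c (n + s - s))) n =
  2 * cosprod x K c n - cosprod x K c (n - s) - cosprod x K c (n + s).
Proof.
rewrite !cosprodB cosprod_shift (@cosprod_shift R x K s c) .
rewrite (@cosprod_shift R x K s (fun m => c (m - s))) cosprod_shift addrK; ring.
Qed.

Lemma sum_sqr_grid c (q m : nat) : (0 < q)%N ->
  \sum_(l < q) (zcos (q * m) (fun n => c n - c (n - q%:Z)) (grid R q l) ^+ 2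
              + zsin (q * m) (fun n => c n - c (n - q%:Z)) (grid R q l) ^+ 2) =
  q%:R * \sum_(r < q)
    (c ((q * m)%N%:Z - q%:Z + r%:Z) - c (- (q * m)%N%:Z - q%:Z + r%:Z)) ^+ 2.
Proof.
move=> q0; rewrite -parseval_grid; apply: eq_bigr => l _.
have qgrid (n : int) : (n + q%:Z)%:~R * grid R q l = n%:~R * grid R q l + l%:Z%:~R * (2 * pi).
  by rewrite /grid intrD; field; rewrite pnatr_eq0; lia.
by congr (_ ^+ 2 + _ ^+ 2); rewrite /zcos /zsin zsum_telescope // => n;
  rewrite qgrid ?cos_int_2pi ?sin_int_2pi.
Qed.

End LimitContradiction.

(** * Impossibility of the limit configuration *)

Section NoLimit.
Variables (R : realType) (C : int * int -> R) (x : nat -> R) (K : nat) (a t : int -> R).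
Hypothesis evenC : forall g, C (- g) = C g.
Hypothesis psdC : psd C.
Hypothesis C_center : forall n, C (0, n) = cosprod x K a n.
Hypothesis C_top : forall n, C (1, n) = cosprod x K t n.
Hypothesis C_far : forall d n, (2 <= `|d|)%N -> C (d, n) = 0.
Hypothesis a_even : forall n : int, a (- n) = a n.
Hypothesis a1 : forall n : int, n != 0 -> a n ^+ 2 = 1.
Hypothesis t0 : forall n : int, 0 < n -> t n = 0.
Hypothesis t1 : forall n : int, n <= 0 -> t n ^+ 2 = 1.

Let common_period : exists2 q : nat, (0 < q)%N & exists n1 : nat, forall n : nat,
  (n1 <= n)%N -> a (n + q)%N%:Z = a n%:Z /\ t (- (n + q)%N%:Z) = t (- n%:Z).
Proof.
have a1' (n : nat) : (0 < n)%N -> a n%:Z ^+ 2 = 1 by move=> n0; apply: a1; lia.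
have [qa qa0 [na ha]] := central_periodic evenC psdC C_center a1'.
have [qt qt0 [nt ht]] := top_periodic evenC psdC C_top t0 t1.
have iter (f : nat -> R) p n1 : (forall n, (n1 <= n)%N -> f (n + p)%N = f n) ->
    forall k n, (n1 <= n)%N -> f (n + p * k)%N = f n.
  move=> hf; elim=> [|k IH] n hn; first by rewrite muln0 addn0.
  by rewrite mulnS addnCA addnC hf ?IH //; lia.
exists (qa * qt)%N; first by rewrite muln_gt0 qa0.
exists (na + nt)%N => n hn; split.
  by apply: (iter (fun n => a n%:Z) qa na) => //; lia.
rewrite mulnC.
by apply: (iter (fun n => t (- n%:Z)) qt nt) => //; lia.
Qed.

Lemma limit_configuration_absurd : False.
Proof.
have [q q0 [n1 per]] := common_period.
have qR : 0 < q%:R :> R by rewrite ltr0n.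
pose W0 := (n1 + q + 1)%N.
pose alpha n := a n - a (n - q%:Z).
pose beta n := t n - t (n - q%:Z).
have alpha0 n : (W0 <= `|n|)%N -> alpha n = 0.
  rewrite /alpha /W0 => hn; have [n0|n0] := leP 0 n.
    have [] := per (`|n| - q)%N ltac:(lia).
    rewrite (_ : (`|n| - q + q)%N%:Z = n); last by lia.
    by rewrite (_ : (`|n| - q)%N%:Z = n - q%:Z) => [->|]; [rewrite subrr|lia].
  have [] := per `|n|%N ltac:(lia).
  rewrite (_ : (`|n| + q)%N%:Z = - (n - q%:Z)); last by lia.
  rewrite (_ : `|n|%N%:Z = - n); last by lia.
  by rewrite !a_even => ->; rewrite subrr.
have beta0 n : (W0 <= `|n|)%N -> beta n = 0.
  rewrite /beta /W0 => hn; have [n0|n0] := leP 0 n.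
    by rewrite !t0 ?subrr //; lia.
  have [_] := per `|n|%N ltac:(lia).
  rewrite (_ : - (`|n| + q)%N%:Z = n - q%:Z); last by lia.
  rewrite (_ : - `|n|%N%:Z = n); last by lia.
  by move=> ->; rewrite subrr.
(* [W] must be a multiple of q for the telescoping sums; the slack covers the supports, the shifts
   by q and the K factors. *)
pose m := (W0 + 3 * q + K + 2)%N.
pose W := (q * m)%N.
have mW : (m <= W)%N by rewrite leq_pmull.
pose zeta n := alpha n - alpha (n + q%:Z).
pose eta n := beta n - beta (n + q%:Z).
(* C' collects the coefficients of F_N |1 - e^{iqt}|^2; unlike those of F_N they
   are finitely supported in each of the two limits. *)
pose C' (g : int * int) := 2 * C g - C (g - (0, q%:Z)) - C (g + (0, q%:Z)).
have psdC' : psd C' by exact: psd_second_difference.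
have zeta0 n : (W0 + q <= `|n|)%N -> zeta n = 0.
  by move=> h; rewrite /zeta !alpha0 ?subrr //; lia.
have eta0 n : (W0 + q <= `|n|)%N -> eta n = 0.
  by move=> h; rewrite /eta !beta0 ?subrr //; lia.
have C'0 n : C' (0, n) = cosprod x K zeta n.
  rewrite cosprod_second_difference /C' -!C_center.
  by congr (_ * _ - C (_, _) - C (_, _)); rewrite /= ?subr0 ?addr0.
have C'1 n : C' (1, n) = cosprod x K eta n.
  rewrite cosprod_second_difference /C' -!C_top.
  by congr (_ * _ - C (_, _) - C (_, _)); rewrite /= ?subr0 ?addr0.
have C'N n : C' (-1, n) = C' (1, - n).
  rewrite /C' -[C (-1, n)]evenC -[C ((-1, n) - _)]evenC -[C ((-1, n) + _)]evenC.
  rewrite -addrA [X in _ + X]addrC addrA.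
  by congr (_ * C (_, _) - C (_, _) - C (_, _)); rewrite /= ?opprD ?opprK ?subr0 ?addr0 ?oppr0.
have C'far d n : (2 <= `|d|)%N || (W <= `|n|)%N -> C' (d, n) = 0.
  case/orP => h; first by rewrite /C' !C_far ?mulr0 ?subr0 //= ?subr0 ?addr0.
  have [d2|d2] := leqP 2 `|d|; first by rewrite /C' !C_far ?mulr0 ?subr0 //= ?subr0 ?addr0.
  have : d = 0 \/ d = 1 \/ d = -1 by lia.
  case=> [->|[->|->]]; rewrite ?C'N ?C'0 ?C'1 (cosprod_eq0 _ zeta0, cosprod_eq0 _ eta0) //; lia.
pose P u := \prod_(j < K) (cos u - x j).
(* The blocks d = 1 and d = -1 contribute equally, whence the factor 4 after squaring; the phase s
   is free, so the modulus of the top transform appears. *)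
have pointwise u : 4 * P u ^+ 2 * (zcos W eta u ^+ 2 + zsin W eta u ^+ 2)
    <= P u ^+ 2 * zcos W zeta u ^+ 2.
  have /sqr_le_of_rotation : forall s, 0 <= P u * zcos W zeta u +
     (2 * P u * zcos W eta u * cos s - 2 * P u * zsin W eta u * sin s).
    move=> s; have := psd_block_ge0 s u psdC' C'far.
    rewrite -[X in _ + _ + X](@zsum_opp _ W); last 2 first.
    - by rewrite C'far ?mul0r //; lia.
    - by rewrite C'far ?mul0r //; lia.
    have -> : zsum W (fun n => C' (-1, - n) * cos ((- n)%:~R * u - s)) =
        zsum W (fun n => C' (1, n) * cos (n%:~R * u + s)).
      by apply: eq_zsum => n; rewrite C'N opprK intrN mulNr -opprD cosN.
    rewrite (@eq_zsum _ _ (fun n => C' (1, n) * _) (fun n => cosprod x K eta n * cos (n%:~R * u + s))); last first.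
      by move=> n; rewrite C'1.
    rewrite (@eq_zsum _ _ (fun n => C' (0, n) * _) (fun n => cosprod x K zeta n * cos (n%:~R * u + 0))); last first.
      by move=> n; rewrite C'0 addr0.
    rewrite !(@zsum_cosprod _ x K _ (W0 + q)) //; try by lia.
    rewrite !zsum_cosD cos0 sin0 -/(P u); congr (_ <= _); ring.
  by congr (_ <= _); ring.
pose h u := zcos W alpha u ^+ 2 + zsin W alpha u ^+ 2 -
  4 * (zcos W beta u ^+ 2 + zsin W beta u ^+ 2).
have h_cont : continuous h.
  move=> u; have sq (f : R -> R) : continuous f -> (fun v => f v ^+ 2) @ u --> f u ^+ 2.
    by move=> cf; exact: (cvgM (cf u) (cf u)).
  apply: cvgB.
    by apply: cvgD; apply: sq; [exact: zcos_continuous|exact: zsin_continuous].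
  apply: cvgM; first exact: cvg_cst.
  by apply: cvgD; apply: sq; [exact: zcos_continuous|exact: zsin_continuous].
have h_ge0 : forall u, 0 <= h u.
  (* Passing from [alpha], [beta] to [zeta], [eta] costs a factor 2 (1 - cos (q u)) in the squares.
     One more such factor makes a perfect square, which continuity removes together with the square
     of [P]. *)
  apply: (@ge0_of_mul_sqr_cos _ _ q 1 q0 h_cont).
  apply: (@ge0_of_mul_cosprod _ (fun u => h u * (cos (q%:R * u) - 1) ^+ 2) x K) => u.
    have cq : (fun v => cos (q%:R * v) - 1) @ u --> cos (q%:R * u) - 1.
      apply: cvgB; last exact: cvg_cst.
      apply: (@cvg_comp _ _ _ (fun v => q%:R * v) (@cos R)); last exact: continuous_cos.
      by apply: cvgM; [exact: cvg_cst|exact: cvg_id].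
    by apply: (cvgM (h_cont u)); exact: (cvgM cq cq).
  have := pointwise u.
  have := @sqr_difference _ alpha W0 W q alpha0 ltac:(lia) u.
  have := @sqr_difference _ beta W0 W q beta0 ltac:(lia) u.
  rewrite -/eta -/zeta -/(P u) /h => -> ez.
  have : 0 <= P u ^+ 2 * zsin W zeta u ^+ 2 by rewrite mulr_ge0 ?sqr_ge0.
  have -> : P u ^+ 2 * zsin W zeta u ^+ 2 = 
   P u ^+ 2 * (2 * (1 - cos (q%:R * u)) * (zcos W alpha u ^+ 2 + zsin W alpha u ^+ 2)) - 
    P u ^+ 2 * zcos W zeta u ^+ 2 by rewrite -ez; ring.
  have : 0 <= 1 - cos (q%:R * u) by rewrite subr_ge0 cos_le1.
  move: (cos _) (P u ^+ 2) (zcos _ _ _ ^+ 2 + _) (zcos _ _ _ ^+ 2 + _) => c p B A c0 h1 h2.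
  have h3 : 0 <= 2 * (1 - c) * (p * (A - 4 * B)) by lra.
  have := mulr_ge0 c0 h3.
  have -> : (1 - c) * (2 * (1 - c) * (p * (A - 4 * B))) = 2 * ((A - 4 * B) * p * (c - 1) ^+ 2) by ring.
  lra.
have : 0 <= \sum_(l < q) h (grid R q l) by apply: sumr_ge0.
rewrite /h sumrB -mulr_sumr !sum_sqr_grid //.
have -> : \sum_(r < q) (t ((q * m)%N%:Z - q%:Z + r%:Z) - t (- (q * m)%N%:Z - q%:Z + r%:Z)) ^+ 2
    = q%:R.
  rewrite -[RHS]mulr1 -[q in RHS]card_ord mulr_natl -sumr_const.
  apply: eq_bigr => r _; rewrite t0 ?sub0r ?sqrrN ?t1 //; move: mW; rewrite /W; have := ltn_ord r; nia.
have : \sum_(r < q) (a ((q * m)%N%:Z - q%:Z + r%:Z) - a (- (q * m)%N%:Z - q%:Z + r%:Z)) ^+ 2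
    <= 4 * q%:R - 4.
  (* The residue 0 compares the entries at W - q and -(W + q), equal by evenness and periodicity.
     Every other residue contributes at most 4. *)
  pose r0 := Ordinal q0.
  have -> : 4 * q%:R - 4 = \sum_(r < q | r != r0) 4 :> R.
    rewrite -[q in LHS]card_ord mulr_natr -sumr_const (bigD1 r0) //=.
    by rewrite addrAC subrr add0r.
  rewrite -/W (bigD1 r0) //= !addr0.
  have qW : (W0 + q <= W)%N by move: mW; rewrite /m; lia.
  have [aW _] := per (W - q)%N ltac:(rewrite /W0 in qW; lia).
  have [aWq _] := per W ltac:(rewrite /W0 in qW; lia).
  rewrite (_ : - W%:Z - q%:Z = - (W + q)%N%:Z); last by lia.
  rewrite a_even aWq (_ : W%:Z - q%:Z = (W - q)%N%:Z); last by move: qW; clear; lia.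
  rewrite -aW subnK ?subrr ?expr0n ?add0r; last by move: qW; clear; lia.
  apply: ler_sum => r _; have rq := ltn_ord r.
  have := @a1 ((W - q)%N%:Z + r%:Z) ltac:(rewrite /W0 in qW; lia).
  have := @a1 (- (W + q)%N%:Z + r%:Z) ltac:(rewrite /W0 in qW; lia).
  move: (a _) (a _) => u v hu hv.
  have : 0 <= (u + v) ^+ 2 by rewrite sqr_ge0.
  by rewrite sqrrD sqrrB hu hv; lra.
move=> le; rewrite subr_ge0 mulrCA ler_pM2l // => le'; lra.
Qed.

End NoLimit.

(** * From few zeros to the limit configuration *)

Section SignPattern.
Variable R : realType.

(** These are the Chebyshev polynomials; the two-term recurrence calls for induction on consecutive
    pairs. *)
Lemma cos_mul_poly (n : nat) : exists T : {poly R}, forall t, cos (n%:R * t) = T.[cos t].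
Proof.
suff [] : (exists T : {poly R}, forall t, cos (n%:R * t) = T.[cos t]) /\
  (exists T : {poly R}, forall t, cos (n.+1%:R * t) = T.[cos t]) by [].
elim: n => [|n [[T0 h0] [T1 h1]]].
  split; first by exists 1 => t; rewrite mul0r cos0 hornerC.
  by exists 'X => t; rewrite mul1r hornerX.
split; first by exists T1.
exists ('X * T1 *+ 2 - T0) => t.
rewrite hornerD hornerN hornerMn hornerM hornerX -h0 -h1.
have -> : n.+2%:R * t = n.+1%:R * t + t by rewrite -natr1 mulrDl mul1r.
have -> : n%:R * t = n.+1%:R * t - t by rewrite -natr1 mulrDl mul1r addrK.
by rewrite cosD cosB; ring.
Qed.

Lemma cos_poly_horner (N : nat) (A : 'I_N.+1 -> R) :
  exists g : {poly R}, forall t, cos_poly A t = g.[cos t].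
Proof.
have [T hT] := choice cos_mul_poly.
exists (\sum_(n < N.+1) A n *: T n) => t.
by rewrite horner_sum; apply: eq_bigr => n _; rewrite hornerZ -hT.
Qed.

(* The points of xs are the zeros at which g changes sign. *)
Lemma poly_sign_pattern (g : {poly R}) : exists (s : R) (xs : seq R),
  [/\ s ^+ 2 = 1, uniq xs, (forall r, r \in xs -> root g r /\ -1 <= r <= 1) &
      forall y, -1 <= y <= 1 -> 0 <= s * g.[y] * \prod_(r <- xs) (y - r)].
Proof.
elim: (size g) {-2}g (leqnn (size g)) => [|n IH] {}g sg.
  exists 1, [::]; split => // [|y _]; first by rewrite expr1n.
  by move: sg; rewrite leqn0 size_poly_eq0 => /eqP->; rewrite horner0 mulr0 mul0r.
have [->|g0] := eqVneq g 0.
  exists 1, [::]; split => // [|y _]; first by rewrite expr1n.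
  by rewrite horner0 mulr0 mul0r.
have [[r [rg rI]]|noroot] := pselect (exists r, root g r /\ -1 <= r <= 1).
  have /factor_theorem[h gh] := rg.
  have sh : (size h <= n)%N.
    have h0 : h != 0 by apply: contra_neq g0 => h0; rewrite gh h0 mul0r.
    by move: sg; rewrite gh size_Mmonic ?monicXsubC // size_XsubC addn2 /=.
  have [s [xs [s1 uxs hxs spos]]] := IH h sh.
  have hroot u : root h u -> root g u by rewrite gh rootM => ->.
  (* If the quotient already changes sign at [r], the new factor cancels that change and [r] leaves
     the list; otherwise [r] joins it. *)
  have [rxs|rxs] := boolP (r \in xs).
    exists s, (rem r xs); split => //; first exact: rem_uniq.
      by move=> u /mem_rem/hxs[/hroot].
    move=> y yI; have := spos y yI.
    rewrite (big_rem r) //= gh hornerM hornerXsubC; congr (_ <= _); ring.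
  exists s, (r :: xs); split => //; first by rewrite /= rxs.
    by move=> u; rewrite inE => /orP[/eqP->//|/hxs[/hroot]].
  move=> y yI; rewrite big_cons gh hornerM hornerXsubC.
  have -> : s * (h.[y] * (y - r)) * ((y - r) * \prod_(j <- xs) (y - j)) =
    (s * h.[y] * \prod_(j <- xs) (y - j)) * (y - r) ^+ 2 by ring.
  by rewrite mulr_ge0 ?sqr_ge0 ?spos.
(* Without roots in [-1, 1] the intermediate value theorem fixes the sign, which is read off at
   -1. *)
pose s : R := if 0 <= g.[-1] then 1 else -1.
exists s, [::]; split => // [|y yI]; first by rewrite /s; case: ifP; rewrite ?sqrrN expr1n.
rewrite big_nil mulr1 leNgt; apply/negP => sy.
have s0 : 0 <= s * g.[-1].
  by rewrite /s; case: ifPn; rewrite ?mul1r // mulN1r oppr_ge0 -ltNge => /ltW.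
have [||u uI] := @poly_ivt R (- s *: g) (-1) y.
- by case/andP: yI.
- by rewrite !hornerZ !mulNr oppr_le0 s0 oppr_ge0 ltW.
have s_neq0 : - s != 0 by rewrite oppr_eq0 /s; case: ifP; rewrite ?oppr_eq0 oner_eq0.
rewrite /root hornerZ mulf_eq0 (negbTE s_neq0) /= => gu; apply: noroot; exists u.
by split => //; move: uI yI => /andP[h1 h2] /andP[_ h3]; rewrite h1 (le_trans h2).
Qed.

(** [acos] maps distinct points of [-1, 1] to distinct zeros in [0, pi]. *)
Lemma size_le_num_zeros (f : R -> R) (K : nat) (xs : seq R) :
  (num_zeros f < K%:R%:E)%E -> uniq xs ->
  (forall r, r \in xs -> -1 <= r <= 1 /\ f (acos r) = 0) -> (size xs <= K)%N.
Proof.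
rewrite /num_zeros /counting; case: ifPn => [/asboolP fin|_]; last by rewrite ltNge leey.
rewrite lte_fin ltr_nat => cK uxs hxs; apply: leq_trans (ltnW cK).
rewrite -(size_map (@acos R)); apply: uniq_leq_size.
  rewrite map_inj_in_uniq // => u v /hxs[uI _] /hxs[vI _] /(congr1 (@cos R)).
  by rewrite !acosK // in_itv.
move=> _ /mapP[u /hxs[uI fu] ->]; rewrite in_fset_set // inE /=; split => //.
rewrite acos_ge0 //=; apply: le_trans (acos_lepi uI) _.
by have := pi_ge0 R; lra.
Qed.

Lemma few_zeros_multiplier (N K : nat) : (min_zeros_pm1 R N < K%:R%:E)%E ->
  exists A x : nat -> R, [/\ forall n, (n <= N)%N -> A n ^+ 2 = 1,
    forall j, -1 <= x j <= 1 &
    forall t, 0 <= \prod_(j < K) (cos t - x j) * \sum_(n < N.+1) A n * cos (n%:R * t)].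
Proof.
have [A A1 ->] := min_zeros_pm1_attained R N => zA.
have [g hg] := cos_poly_horner A.
have [s [xs [s1 uxs hxs spos]]] := poly_sign_pattern g.
have xsK : (size xs <= K)%N.
  apply: (size_le_num_zeros zA uxs) => r /hxs[/eqP rg rI]; split => //.
  by rewrite hg acosK ?in_itv.
(* The list is padded with -1 to exactly K entries: the extra factors cos t + 1 are nonnegative. The
   global sign is absorbed into the coefficients. *)
exists (fun n => s * A (inord n)), (nth (-1) xs); split.
- move=> n nN; rewrite exprMn s1 mul1r.
  by case: (A1 (inord n)) => ->; rewrite ?sqrrN expr1n.
- move=> j; have [jxs|jxs] := ltnP j (size xs); first by have [] := hxs _ (mem_nth (-1) jxs).
  by rewrite nth_default // lexx /=; lra.
move=> t.
have -> : \sum_(n < N.+1) s * A (inord n) * cos (n%:R * t) = s * g.[cos t].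
  rewrite -hg /cos_poly mulr_sumr; apply: eq_bigr => n _.
  by rewrite inord_val mulrA.
have -> : \prod_(j < K) (cos t - nth (-1) xs j) =
    \prod_(r <- xs) (cos t - r) * (cos t + 1) ^+ (K - size xs).
  rewrite -(big_mkord xpredT (fun j => cos t - nth (-1) xs j)).
  rewrite (@big_cat_nat _ _ _ (size xs)) //= -(big_nth (-1) xpredT (fun r => cos t - r)).
  congr (_ * _); rewrite (eq_big_nat _ _ (F2 := fun=> cos t + 1)).
    by rewrite prodr_const_nat.
  by move=> j /andP[h _]; rewrite nth_default // opprK.
rewrite mulrAC mulr_ge0 ?exprn_ge0 //; first by rewrite mulrC spos // cos_geN1 cos_le1.
Qed.

End SignPattern.

(** * Passage to the limit along an ultrafilter *)

Section UltraLimit.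
Variable R : realType.

Lemma ultra_bounded_cvg (U : set_system nat) (s : nat -> R) (B : R) :
  UltraFilter U -> (forall i, `|s i| <= B) -> exists l : R, s @ U --> l.
Proof.
move=> UU sB.
have : (s @ U) `[-B, B]%classic.
  by apply: nearW => i /=; rewrite in_itv /= -ler_norml.
move=> /(@segment_compact R (- B) B (s @ U) _)[l [_ lcl]].
exists l => V /= Vl; have [//|UV] := in_ultra_setVsetC (s @^-1` V) UU.
by have [y []] := lcl (~` V) V UV Vl.
Qed.

Lemma cvg_cosprod (U : set_system nat) (x : nat -> nat -> R) (c : nat -> int -> R)
    (xl : nat -> R) (cl : int -> R) (K : nat) (n : int) : Filter U ->
  (forall j, x ^~ j @ U --> xl j) -> (forall m, c ^~ m @ U --> cl m) ->
  (fun i => cosprod (x i) K (c i) n) @ U --> cosprod xl K cl n.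
Proof.
move=> FU hx hc; elim: K n => [|K IH] n; first exact: hc.
apply: cvgB; last by apply: cvgM; [exact: hx|exact: IH].
by apply: cvgM; [apply: cvgD; exact: IH|exact: cvg_cst].
Qed.

(* Coefficients of [2 * \sum_(n <= N) A n cos (n t)] in the exponential basis. *)
Definition sym_coef (N : nat) (A : nat -> R) (n : int) : R :=
  if n == 0 then 2 * A 0%N else if (`|n| <= N)%N then A `|n|%N else 0.

Lemma sym_coef_even N A n : sym_coef N A (- n) = sym_coef N A n.
Proof. by rewrite /sym_coef oppr_eq0 abszN. Qed.

Lemma sym_coef_out N A n : (N < `|n|)%N -> sym_coef N A n = 0.
Proof. by rewrite /sym_coef ltnNge; case: eqP => [->|_] //= /negbTE->. Qed.

Lemma sym_coef_in N A n : n != 0 -> (`|n| <= N)%N -> sym_coef N A n = A `|n|%N.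
Proof. by rewrite /sym_coef => /negbTE-> ->. Qed.

Lemma zsum_sym_coef N A t : zsum N.+1 (fun n => sym_coef N A n * cos (n%:~R * t)) =
  2 * \sum_(n < N.+1) A n * cos (n%:R * t).
Proof.
set g := fun n : int => _.
have gE M : zsum M g + g M%:Z = g 0 + 2 * \sum_(n < M) g n.+1%:Z.
  elim: M => [|M IH]; first by rewrite /zsum big_geq // big_ord0 mulr0 add0r addr0.
  have -> : g M.+1%:Z = g (- M.+1%:Z).
    by rewrite /g sym_coef_even intrN mulNr cosN.
  rewrite zsumS -[_ + _ + g M%:Z]addrA IH big_ord_recr /=.
  have -> : g (- M.+1%:Z) = g M.+1%:Z.
    by rewrite /g sym_coef_even intrN mulNr cosN.
  ring.
have gN : g N.+1%:Z = 0 by rewrite /g sym_coef_out ?mul0r.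
rewrite -[LHS]addr0 -gN gE big_ord_recr /= gN addr0 big_ord_recl mulrDr.
congr (_ + 2 * _); first by rewrite /g /sym_coef /= mulrA.
apply: eq_bigr => n _; rewrite /g sym_coef_in //= ?pmulrn //.
Qed.

Lemma psd_multiplier_coef (N K : nat) (A x : nat -> R) :
  (forall t, 0 <= \prod_(j < K) (cos t - x j) * \sum_(n < N.+1) A n * cos (n%:R * t)) ->
  psd (cosprod x K (sym_coef N A)).
Proof.
move=> F0.
have a0 n : (N.+1 <= `|n|)%N -> sym_coef N A n = 0 by exact: sym_coef_out.
apply: (@psd_coef_nonneg_trig _ _ (N.+1 + K + 2)%N) => [n|n h|t].
- rewrite -cosprod_opp; apply: eq_cosprod => m; exact: sym_coef_even.
- by apply: (cosprod_eq0 _ a0); lia.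
rewrite (@eq_zsum _ _ _ (fun n => cosprod x K (sym_coef N A) n * cos (n%:~R * t + 0))); last first.
  by move=> n; rewrite addr0.
rewrite (zsum_cosprod _ _ _ a0) //.
under eq_zsum do rewrite addr0.
rewrite (@zsum_widen _ N.+1); [|by lia|by move=> n h; rewrite a0 ?mul0r].
by rewrite zsum_sym_coef mulrCA mulr_ge0.
Qed.

Lemma multipliers_absurd (K : nat) (N : nat -> nat) (A x : nat -> nat -> R) :
  (forall i, (i <= N i)%N) ->
  (forall i n, (n <= N i)%N -> A i n ^+ 2 = 1) ->
  (forall i j, -1 <= x i j <= 1) ->
  (forall i t, 0 <= \prod_(j < K) (cos t - x i j) *
                    \sum_(n < (N i).+1) A i n * cos (n%:R * t)) -> False.
Proof.
move=> Ni A1 x1 F0.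
(* A single ultrafilter finer than the neighbourhoods of infinity makes all bounded sequences below
   converge at once, with no diagonal extraction. *)
have [U [UU ooU]] := @ultraFilterLemma nat \oo _.
have PU : ProperFilter U by exact: ultra_proper.
have evU (P : nat -> Prop) (n0 : nat) : (forall i, (n0 <= i)%N -> P i) -> \forall i \near U, P i.
  by move=> h; apply: ooU; exists n0.
pose a i := sym_coef (N i) (A i).
have a_bound i n : `|a i n| <= 2.
  have A_bound j : (j <= N i)%N -> `|A i j| <= 1.
    by move=> /A1/eqP; rewrite sqrf_eq1 => /orP[]/eqP->; rewrite ?normrN normr1.
  rewrite /a /sym_coef; case: ifP => _.
    by rewrite normrM ger0_norm // -[leRHS]mulr1 ler_pM2l // A_bound.
  by case: ifPn => h; [apply: le_trans (A_bound _ h) _; lra|rewrite normr0].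
have cvg_x : forall j, exists l : R, x ^~ j @ U --> l.
  by move=> j; apply: (@ultra_bounded_cvg _ _ 1) => i; rewrite ler_norml.
have [xl hxl] := choice cvg_x.
have cvg_a : forall g : int * int, exists l : R, (fun i => a i (g.1 * (N i)%:Z + g.2)) @ U --> l.
  by move=> g; apply: (@ultra_bounded_cvg _ _ 2) => i; exact: a_bound.
have [al hal] := choice cvg_a.
pose C (g : int * int) := cosprod xl K (fun m => al (g.1, m)) g.2.
pose c i := cosprod (x i) K (a i).
have cC (g : int * int) : (fun i => c i (g.1 * (N i)%:Z + g.2)) @ U --> C g.
  have h m : (fun i => a i (m + g.1 * (N i)%:Z)) @ U --> al (g.1, m).
    by have := hal (g.1, m); under eq_fun do rewrite addrC.
  have -> : (fun i => c i (g.1 * (N i)%:Z + g.2)) =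
      (fun i => cosprod (x i) K (fun m => a i (m + g.1 * (N i)%:Z)) g.2).
    by apply/funext => i; rewrite cosprod_shift addrC.
  exact: (@cvg_cosprod U x (fun i m => a i (m + g.1 * (N i)%:Z)) xl
    (fun m => al (g.1, m))).
have al_unique g l (n0 : nat) :
    (forall i, (n0 <= i)%N -> a i (g.1 * (N i)%:Z + g.2) = l) -> al g = l.
  move=> h; apply: (cvg_unique _ (hal g)) => //.
  by apply: cvg_near_cst; exact: evU h.
have al_opp d n : al (- d, - n) = al (d, n).
  have := hal (- d, - n); rewrite (_ : (fun i => _) = (fun i => a i (d * (N i)%:Z + n))).
    by move=> h; exact: (cvg_unique _ h (hal (d, n))).
  by apply/funext => i /=; rewrite mulNr -opprD /a sym_coef_even.
have al_sqr g (n0 : nat) :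
    (forall i, (n0 <= i)%N -> a i (g.1 * (N i)%:Z + g.2) ^+ 2 = 1) -> al g ^+ 2 = 1.
  move=> h; apply: (cvg_unique _ (cvgM (hal g) (hal g))) => //.
  by apply: cvg_near_cst; exact: evU h.
(* The frequency 0 is excluded because [sym_coef] doubles the constant coefficient. *)
have a_sqr i n : n != 0 -> (`|n| <= N i)%N -> a i n ^+ 2 = 1.
  by move=> n0 h; rewrite /a sym_coef_in // A1.
apply: (@limit_configuration_absurd R C xl K (fun n => al (0, n)) (fun n => al (1, n))).
- move=> [d n]; rewrite /C /= -cosprod_opp; apply: eq_cosprod => m.
  exact: al_opp.
- move=> X; pose Y i := [seq (p.1, p.2.1 * (N i)%:Z + p.2.2) | p : R * (int * int) <- X].
  have cvgX : (fun i => qform (c i) (Y i) (Y i)) @ U --> qform C X X.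
    rewrite /qform /Y; under eq_fun do rewrite big_map.
    apply: (cvg_big add_continuous) => p _.
    under eq_fun do rewrite big_map.
    apply: (cvg_big add_continuous) => q _ /=.
    apply: cvgM; first exact: cvg_cst.
    have := cC (p.2 - q.2).
    under eq_fun do rewrite /= mulrBl addrACA -opprD.
    exact.
  apply: (cvgr_to_ge cvgX).
  apply: nearW => i; exact: (psd_multiplier_coef (F0 i)).
- by [].
- by [].
(* For |d| at least 2 and [i] > |m| the frequency d N + m exceeds N in modulus, so the limit
   sequence is identically zero; the threshold n - K - 1 merely places [n] beyond it. *)
- move=> d n d2; rewrite /C /=; apply: (@cosprod_gt0 _ _ _ _ (n - K%:Z - 1)) => [m _|]; last by lia.
  apply: (@al_unique _ _ `|m|.+1) => i hi; rewrite /a sym_coef_out //=.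
  have := Ni i; nia.
- by move=> n; rewrite -al_opp oppr0 opprK.
- move=> n n0; apply: (@al_sqr (0, n) `|n|%N) => i hi /=; rewrite mul0r add0r a_sqr //.
  by have := Ni i; lia.
- move=> n n0; apply: (@al_unique (1, n) _ 0%N) => i _; rewrite /a sym_coef_out //=; lia.
- move=> n n0; apply: (@al_sqr (1, n) `|n|.+1%N) => i hi /=; rewrite a_sqr //; have := Ni i; lia.
Qed.

End UltraLimit.

Theorem theorem3 (R : realType) :
  min_zeros_pm1 R N @[N --> \oo] --> +oo%E.
Proof.
apply/cvgeyPge => B; apply: contrapT => nB.
pose K := Num.bound `|B|.
have BK : B <= K%:R by apply: le_trans (ler_norm B) (ltW (archi_boundP _)).
(* Failure of divergence yields arbitrarily large N with fewer than the fixed number K of zeros. *)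
have exN : forall i, exists N, (i <= N)%N /\ (min_zeros_pm1 R N < K%:R%:E)%E.
  move=> i; apply: contrapT => h; apply: nB; exists i => // n /= ni.
  rewrite leNgt; apply/negP => lt; apply: h; exists n; split => //.
  by apply: lt_le_trans lt _; rewrite lee_fin.
have [N hN] := choice exN.
have [Ax hAx] := choice (fun i => few_zeros_multiplier (proj2 (hN i))).
have [x hx] := choice hAx.
apply: (@multipliers_absurd R K N Ax x).
- by move=> i; have [] := hN i.
- by move=> i; have [] := hx i.
- by move=> i; have [] := hx i.
- by move=> i; have [] := hx i.
Qed.
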